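(* Let $A,B$ be $n$-qubit matrices (in $\mathbb{C}^{2^n\times 2^n}$) with $A$ and $A+B$ invertible. Let $U_A'$ be an $(\alpha_A',m_A',0)$-block-encoding of $A^{-1}$ (implemented via fast inversion) and $U_B$ an $(\alpha_B,m_B,0)$-block-encoding of $B$. Let $\tilde\sigma_{\min}>0$ be a lower bound for the smallest singular value of $I+A^{-1}B$; it can be chosen to be $1/(1+\|(A+B)^{-1}\|\|B\|)$. Then for any $\delta'>0$ there exists a $$\Bigl(\frac{4\alpha_A'}{3\tilde\sigma_{\min}},\;2m_A'+m_B+3,\;\delta'\Bigr)\text{-block-encoding of }(A+B)^{-1}$$ using $$\mathcal{O}\Bigl(\frac{\alpha_A'\alpha_B}{\tilde\sigma_{\min}}\log\Bigl(\frac{\alpha_A'}{\delta'\tilde\sigma_{\min}}\Bigr)\Bigr)$$ applications of $U_A'$, $U_B$, their controlled versions, their inverses, and other primitive gates.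
   Context: Block-encoding: an $(m+n)$-qubit unitary $U$ is an $(\alpha,m,\epsilon)$-block-encoding of an $n$-qubit operator $M$ if $\|M-\alpha(\langle 0^m|\otimes I_n)U(|0^m\rangle\otimes I_n)\|\le\epsilon$ in operator norm. ''Implemented via fast inversion'' only refers to how the given $U_A'$ is obtained (with a number of oracle queries independent of the condition number of $A$). Asymptotic notation is read in the usual multi-parameter sense, for $\alpha_A'\alpha_B$ and $\alpha_A'/(\delta'\tilde\sigma_{\min})$ bounded away from $0$ (respectively from $1$), so that the displayed bounds are bounded below. *)

(* Defs.v *)
From HB Require Import structures.
From mathcomp Require Export all_boot all_order all_algebra.
From mathcomp Require Export all_classical all_reals.
From mathcomp Require Export exp.
From mathcomp Require Export complex mxtens.

Set Implicit Arguments.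
Unset Strict Implicit.
Unset Printing Implicit Defensive.

Import Order.TTheory GRing.Theory Num.Theory.
Local Open Scope ring_scope.
Local Open Scope complex_scope.
Local Open Scope sesquilinear_scope.

Section Norms.
Local Open Scope classical_set_scope.
Variable R : realType.
Local Notation C := R[i].

Definition l2norm m (v : 'cV[C]_m) : R :=
  Num.sqrt (\sum_i ComplexField.Normc.normc (v i 0) ^+ 2).

Definition opnorm m p (M : 'M[C]_(m, p)) : R :=
  sup [set l2norm (M *m v) | v in [set v : 'cV[C]_p | l2norm v = 1]].

Definition singular_value m (M : 'M[C]_m) (s : R) : Prop :=
  0 <= s /\ eigenvalue (M^t* *m M) ((s ^+ 2)%:C).

Definition sigma_min m (M : 'M[C]_m) : R := inf [set s | singular_value M s].

End Norms.

Section BlockEncoding.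
Variable R : realType.
Local Notation C := R[i].

Definition ket0 m : 'cV[C]_(2 ^ m) := \col_i ((i : nat) == 0%N)%:R.

(* |0^m> (x) I_n; the casts identify 2 ^ m * 2 ^ n with 2 ^ (m + n). *)
Definition ket0_tens m n : 'M[C]_(2 ^ (m + n), 2 ^ n) :=
  castmx (esym (expnD 2 m n), mul1n (2 ^ n)%N) (ket0 m *t (1%:M : 'M_(2 ^ n))).

Definition block_encoding m n (alpha eps : R)
    (U : 'M[C]_(2 ^ (m + n))) (M : 'M[C]_(2 ^ n)) : Prop :=
  U \is unitarymx /\
  opnorm (M - alpha%:C *: ((ket0_tens m n)^t* *m U *m ket0_tens m n)) <= eps.

End BlockEncoding.

Section Circuits.
Variable R : realType.
Local Notation C := R[i].

(* Qubit 0 is the most significant bit, so that the leading qubits form the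
   left factor of a Kronecker product. *)
Definition qubit k (x : 'I_(2 ^ k)) (i : 'I_k) : bool :=
  odd (x %/ 2 ^ (k - i.+1)).

Lemma basis_state_proof k (b : 'I_k -> bool) :
  (\sum_(i < k) b i * 2 ^ (k - i.+1) < 2 ^ k)%N.
Proof.
elim: k b => [|k IH] b; first by rewrite big_ord0.
rewrite big_ord_recl /= subn1 /= expnS mul2n -addnn -addnS leq_add //.
by case: (b ord0); rewrite ?mul1n.
Qed.

Definition basis_state k (b : 'I_k -> bool) : 'I_(2 ^ k) :=
  Ordinal (basis_state_proof b).

(* U acting on the qubits q 0, ..., q (k - 1), in this order, of an N-qubit
   register, and the identity on the others (q is meant to be injective). *)
Definition on_qubits N k (q : 'I_k -> 'I_N) (U : 'M[C]_(2 ^ k)) :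
    'M[C]_(2 ^ N) :=
  \matrix_(x, y)
    if [forall i, (i \notin codom q) ==> (qubit x i == qubit y i)]
    then U (basis_state (fun j => qubit x (q j)))
           (basis_state (fun j => qubit y (q j)))
    else 0.

(* U applied when every qubit i in S has the value b i (U is meant to act
   trivially on the qubits in S). *)
Definition controlled N (S : {set 'I_N}) (b : 'I_N -> bool)
    (U : 'M[C]_(2 ^ N)) : 'M[C]_(2 ^ N) :=
  \matrix_(x, y)
    if [forall i in S, qubit x i == b i] then U x y else (x == y)%:R.

(* One application of U, of its inverse, or of the version of either that is
   controlled by one further qubit. *)
Inductive application N k (U : 'M[C]_(2 ^ k)) : 'M[C]_(2 ^ N) -> Prop :=
| Application (V : 'M[C]_(2 ^ k)) (q : 'I_k -> 'I_N) (S : {set 'I_N}) of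
    V = U \/ V = invmx U & injective q &
    (#|S| <= 1)%N & (forall j, q j \notin S) :
    application U (controlled S xpredT (on_qubits q V)).

(* Primitive gates: one-qubit gates, possibly controlled by any number of
   further qubits, with either control value. They include CNOT and Toffoli
   gates as well as the phase shifts controlled on |0^m> that are used for
   reflections about the ancilla subspace. *)
Inductive primitive_gate N : 'M[C]_(2 ^ N) -> Prop :=
| PrimitiveGate (V : 'M[C]_(2 ^ 1)) (q : 'I_N) (S : {set 'I_N})
    (b : 'I_N -> bool) of V \is unitarymx & q \notin S :
    primitive_gate (controlled S b (on_qubits (fun=> q) V)).

(* W is a product of exactly d gates on N qubits with oracles UA and UB, where
   N includes every ancilla. *)
Definition circuit_with N kA kB (UA : 'M[C]_(2 ^ kA)) (UB : 'M[C]_(2 ^ kB))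
    (d : nat) (W : 'M[C]_(2 ^ N)) : Prop :=
  exists gs : d.-tuple 'M[C]_(2 ^ N),
    (forall i, [\/ application UA (tnth gs i), application UB (tnth gs i)
                 | primitive_gate (tnth gs i)]) /\
    W = \big[mulmx/1%:M]_(G <- gs) G.

End Circuits.

(* Main.v *)
(* Write X = 1 + A^-1 B, so that (A + B)^-1 = X^-1 A^-1. A linear combination of
   unitaries with one extra qubit turns U_A and U_B into a block-encoding V of
   M = X / alpha with alpha >= 1 + alphaA alphaB, whose singular values lie in
   [beta, 1] for beta = sigma / alpha, and it remains to apply
   p(x) = 3 beta / (4 x) to M^* and to multiply by the encoding of A^-1.

   Polynomial. Let q(y) = (sin N f / (N sin f))^2 with y = (sin f)^2, and let r(y)
   be the probability that a majority of 2l + 1 independent coins of bias q(y) show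
   heads. If N beta = 8/5 then r <= c^l for y >= beta^2 with c < 1, r is close
   to 1 near y = 0, and p(x) = (3 beta / 4) (1 - r(x^2)) / x stays below 1 in
   absolute value on [-1, 1]; it has degree O(N l). Since 1 - r(y) = y t(y), the
   error of t(M^* M) M^* is exactly r(M^* M) M^-1.

   Circuit. With R the reflection about the zero ancillas, Z = R V^* R V satisfies
   (Z + 2 + Z^-1) / 4 = M^* M on the image of the ancilla projector, so the
   Laurent polynomial F(e^(2if)) = e^((2d+1)if) p(cos f) in Z, composed with the
   matching power of the walk, block-encodes p(M^* ). As |F| < 1 on the unit circle,
   Fejer-Riesz gives G with |F|^2 + |G|^2 = 1, and (F, G) is peeled off degree by
   degree into one-qubit rotations alternating with controlled applications of Z.
   Only the reflections in Z have to be controlled. *)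

Require Import Defs.
From mathcomp Require Import zify ring lra.
From mathcomp Require Import spectral sesquilinear sequences trigo.

Import Order.TTheory GRing.Theory Num.Theory.
Set Implicit Arguments.
Unset Strict Implicit.
Unset Printing Implicit Defensive.
Local Open Scope ring_scope.

(** * Polynomials on the unit circle *)

Section CirclePolynomials.
Variable C : numClosedFieldType.
Implicit Types (P Q F G : {poly C}) (z : C).

(** The prescribed normalisation 4 / (3 sigma) decides the shape of the polynomial: it has to follow
    1/x on [beta, 1] and still stay below 4 / (3 beta) on all of [-1, 1], so its cut-off must fall
    between 3 beta / 4 and beta. A Fejer kernel alone decays too slowly for a logarithmic bound; the
    majority vote makes the decay exponential and costs only a factor l in the degree. Since N must
    be an odd integer, N beta = 8/5 is arranged the other way round: N is chosen first and alpha =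
    sigma / beta is enlarged accordingly, which the linear combination of unitaries tolerates.

    The complement G is taken on the whole circle and may be any complex polynomial, so F itself
    appears in the block. Taking a real part, with its extra combination of circuits, is avoided.

    The logarithm contains alphaA / (delta sigma) because the residual r(M^* M) acts on w = (A +
    B)^-1 v, whose norm is at most |alphaA| |v| / sigma. *)

Lemma circle_neq0 z : `|z| = 1 -> z != 0.
Proof. by move=> z1; rewrite -normr_eq0 z1 oner_eq0. Qed.

Lemma circle_mul_conj z : `|z| = 1 -> z * z^* = 1.
Proof. by move=> z1; rewrite -normCK z1 expr1n. Qed.

Lemma circle_conj z : `|z| = 1 -> z^* = z^-1.
Proof.
move=> z1; apply: (mulfI (circle_neq0 z1)).
by rewrite circle_mul_conj // divff // circle_neq0.
Qed.

(** The Cayley transforms (1 + ik) / (1 - ik) of the naturals supply as many distinct points of the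
    circle as the size of [P - Q]. *)
Lemma circle_ext P Q : (forall z, `|z| = 1 -> P.[z] = Q.[z]) -> P = Q.
Proof.
move=> PQ; apply/eqP; rewrite -subr_eq0; apply/eqP/(@roots_geq_poly_eq0 _ _
  [seq (1 + 'i * k%:R) / (1 - 'i * k%:R) | k <- iota 0 (size (P - Q))]); last first.
- by rewrite size_map size_iota.
- rewrite map_inj_in_uniq ?iota_uniq // => j k _ _ /eqP.
  have nz l : 1 - 'i * l%:R != 0 :> C.
    rewrite subr_eq0; apply/eqP => /(congr1 (fun w => w ^+ 2)).
    rewrite exprMn sqrCi expr1n mulN1r => /eqP; rewrite -subr_eq0 opprK.
    by rewrite -natrX addrC natr1 pnatr_eq0.
  rewrite eqr_div // -subr_eq0.
  have -> : (1 + 'i * j%:R) * (1 - 'i * k%:R) - (1 + 'i * k%:R) * (1 - 'i * j%:R)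
     = 2 * 'i * (j%:R - k%:R) :> C by ring.
  by rewrite !mulf_eq0 pnatr_eq0 (negbTE (neq0Ci C)) subr_eq0 eqr_nat /= => /eqP.
apply/allP => _ /mapP[k _ ->]; rewrite /root hornerD hornerN subr_eq0; apply/eqP/PQ.
have cj : 1 + 'i * k%:R = (1 - 'i * k%:R)^* :> C.
  by rewrite rmorphB rmorph1 rmorphM /= conjCi rmorph_nat mulNr opprK.
rewrite normrM cj norm_conjC normfV divff // normr_eq0 subr_eq0.
apply/eqP => /(congr1 (fun w => w ^+ 2)).
rewrite exprMn sqrCi expr1n mulN1r => /eqP; rewrite -subr_eq0 opprK.
by rewrite -natrX addrC natr1 pnatr_eq0.
Qed.

(* z^D conj(P (1 / conj z)), a polynomial when P has degree at most D *)
Definition reciprocal D P : {poly C} := \poly_(k < D.+1) (P`_(D - k))^*.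

Lemma horner_reciprocal D P z : (size P <= D.+1)%N -> z != 0 ->
  (reciprocal D P).[z] = z ^+ D * (P.[(z^*)^-1])^*.
Proof.
move=> sP z0; rewrite horner_poly (horner_coef_wide _ sP) rmorph_sum mulr_sumr.
rewrite [RHS](reindex_inj rev_ord_inj) /=; apply: eq_bigr => k _.
have kD : (k <= D)%N by rewrite -ltnS.
rewrite subSS rmorphM rmorphXn fmorphV /= conjCK mulrCA; congr (_ * _).
by rewrite exprVn -{2}(subnKC kD) exprD -mulrA divff ?mulr1 // expf_neq0.
Qed.

Lemma reciprocal_circle D P z : (size P <= D.+1)%N -> `|z| = 1 ->
  (reciprocal D P).[z] = z ^+ D * (P.[z])^*.
Proof.
by move=> sP z1; rewrite horner_reciprocal ?circle_neq0 // (circle_conj z1) invrK.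
Qed.

Lemma size_reciprocal D P : (size (reciprocal D P) <= D.+1)%N.
Proof. exact: size_poly. Qed.

(* Zeros come in pairs r, 1 / conj r, and for |z| = 1 such a pair contributes
   (z - r)(1 - conj r z) = z |z - r|^2; a zero at 0 is paired with a drop of degree. *)
Lemma self_reciprocal_square D Q :
  (size Q <= (2 * D).+1)%N ->
  (forall z, `|z| = 1 -> z ^+ (2 * D) * (Q.[z])^* = Q.[z]) ->
  (forall z, `|z| = 1 -> Q.[z] != 0) ->
  exists G c, (size G <= D.+1)%N /\
    forall z, `|z| = 1 -> Q.[z] = c * (z ^+ D * `|G.[z]| ^+ 2).
Proof.
elim: D Q => [|D IH] Q sQ selfQ nzQ.
  rewrite muln0 in sQ; exists 1, Q`_0; split; first by rewrite size_poly1.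
  move=> z _; rewrite hornerC normr1 !expr1n !mulr1.
  by rewrite {1}(size1_polyC sQ) hornerC.
have recQ : reciprocal (2 * D.+1) Q = Q.
  by apply: circle_ext => z z1; rewrite reciprocal_circle // selfQ.
have [/factor_theorem[Q' Q'E]|Q0] := boolP (root Q 0).
  rewrite subr0 in Q'E.
  have lead0 : Q`_(2 * D.+1) = 0.
    by rewrite -recQ coef_poly ltnSn subnn Q'E coefMX rmorph0.
  have sQ2 : (size Q <= (2 * D).+2)%N.
    apply/leq_sizeP => j; rewrite leq_eqVlt => /orP[/eqP <-|jl].
      by move: lead0; rewrite mulnS.
    by move/leq_sizeP: sQ; apply; lia.
  have hQ' z : Q.[z] = Q'.[z] * z by rewrite Q'E hornerMX.
  have [|||G [c [sG GE]]] := IH Q'.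
  - have [->|nz] := eqVneq Q' 0; first by rewrite size_poly0.
    by move: sQ2; rewrite Q'E size_mulX.
  - move=> z z1; have h := selfQ z z1; apply: (mulIf (circle_neq0 z1)).
    rewrite -hQ' -h hQ' rmorphM mulnS !exprS.
    transitivity (z * z^* * (z ^+ (2 * D) * Q'.[z]^* * z)); last by ring.
    by rewrite circle_mul_conj // mul1r.
  - by move=> z z1; have := nzQ z z1; rewrite hQ' mulf_eq0 negb_or => /andP[].
  exists G, c; split; first exact: leqW.
  by move=> z z1; rewrite hQ' GE // [z ^+ _.+1]exprS; move: (`|G.[z]| ^+ 2 : C) => w; ring.
have QD : Q`_(2 * D.+1) != 0.
  by rewrite -recQ coef_poly ltnSn subnn fmorph_eq0 -horner_coef0.
have sQE : size Q = (2 * D.+1).+1.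
  apply/eqP; rewrite eqn_leq sQ /= ltnNge; apply/negP => /leq_sizeP/(_ _ (leqnn _)).
  exact/eqP.
have /closed_rootP[r rootr] : size Q != 1 by rewrite sQE.
have r0 : r != 0 by apply: contraNneq Q0 => <-.
have nzr z : `|z| = 1 -> z - r != 0.
  move=> z1; rewrite subr_eq0; apply: contraTneq rootr => <-.
  by rewrite /root nzQ.
pose s := (r^*)^-1.
have s0 : s != 0 by rewrite invr_eq0 fmorph_eq0.
have roots' : root Q s.
  rewrite /root -recQ horner_reciprocal // fmorphV /= conjCK invrK (rootP rootr).
  by rewrite rmorph0 mulr0.
(* A zero equal to its own reflection would lie on the circle, where [Q] has none. *)
have rs : s != r.
  apply/eqP => e; have : `|r| = 1; last first.
    by move=> r1; have := nzr r r1; rewrite subrr eqxx.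
  apply/eqP; rewrite -(@pexpr_eq1 _ _ 2) // normCK -{1}e /s mulVf //.
  by rewrite fmorph_eq0.
have /factor_theorem[Q1 Q1E] := rootr.
have /factor_theorem[Q2 Q2E] : root Q1 s.
  move: roots'; rewrite Q1E rootM => /orP[] //.
  by rewrite root_XsubC (negbTE rs).
pose Q' := (- s) *: Q2.
have hQ' z : `|z| = 1 -> Q.[z] = Q'.[z] * z * `|z - r| ^+ 2.
  move=> z1; rewrite Q1E Q2E !hornerM !hornerXsubC hornerZ normCK rmorphB.
  have zz := circle_mul_conj z1.
  have -> : z - s = - s * z * (z^* - r^*).
    have sr : s * r^* = 1 by rewrite mulVf // fmorph_eq0.
    rewrite mulrBr -mulrA zz mulr1 (_ : - s * z * r^* = - (z * (s * r^*))); last by ring.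
    by rewrite sr mulr1 opprK addrC.
  by ring.
have n0 z : `|z| = 1 -> `|z - r| ^+ 2 != 0.
  by move=> z1; rewrite expf_neq0 // normr_eq0 nzr.
have [|||G [c [sG GE]]] := IH Q'.
- rewrite (leq_trans (size_scale_leq _ _)) //.
  have Q20 : Q2 != 0.
    by apply: contra_eq_neq sQE => e; rewrite Q1E Q2E e !mul0r size_poly0.
  move: sQ; rewrite Q1E Q2E !size_Mmonic ?monicXsubC // ?size_XsubC.
    by lia.
  by rewrite mulf_neq0 ?polyXsubC_eq0.
- move=> z z1; have h := selfQ z z1; apply: (mulIf (circle_neq0 z1)).
  apply: (mulIf (n0 z z1)); rewrite -hQ' // -h hQ' //.
  have wc : (`|z - r| ^+ 2 : C)^* = `|z - r| ^+ 2 by rewrite conj_Creal // realX // normr_real.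
  move: (`|z - r| ^+ 2 : C) wc => w wc; rewrite !rmorphM /= wc mulnS !exprS.
  transitivity (z * z^* * (z ^+ (2 * D) * Q'.[z]^* * z * w)); last by ring.
  by rewrite circle_mul_conj // mul1r.
- by move=> z z1; have := nzQ z z1; rewrite hQ' // !mulf_eq0 !negb_or => /andP[/andP[]].
exists (('X - r%:P) * G), c; split.
  by rewrite (leq_trans (size_polyMleq _ _)) // size_XsubC.
move=> z z1; rewrite hQ' // GE // hornerM hornerXsubC normrM exprMn [z ^+ _.+1]exprS.
by move: (`|z - r| ^+ 2 : C) (`|G.[z]| ^+ 2 : C) => w w'; ring.
Qed.

(** Fejer-Riesz applied to z^D (1 - |F|^2), which agrees on the circle with a polynomial of degree
    at most 2D. Strictness of the bound on [F] excludes zeros on the circle, whose multiplicities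
    would otherwise have to be shown even. *)
Lemma complementary_polynomial D F : (size F <= D.+1)%N ->
  (forall z, `|z| = 1 -> `|F.[z]| < 1) ->
  exists G, (size G <= D.+1)%N /\ forall z, `|z| = 1 -> `|F.[z]| ^+ 2 + `|G.[z]| ^+ 2 = 1.
Proof.
move=> sF F1; pose Q := 'X^D - F * reciprocal D F.
have QE z : `|z| = 1 -> Q.[z] = z ^+ D * (1 - `|F.[z]| ^+ 2).
  move=> z1; rewrite hornerD hornerN hornerM hornerXn reciprocal_circle // normCK.
  by ring.
have F2 z : `|z| = 1 -> 0 < 1 - `|F.[z]| ^+ 2.
  by move=> z1; rewrite subr_gt0 exprn_ilt1 // F1.
have [|||G [c [sG GE]]] := @self_reciprocal_square D Q.
- rewrite (leq_trans (size_polyD _ _)) // size_polyN size_polyXn geq_max.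
  rewrite (leq_trans (size_polyMleq _ _)); last first.
    by rewrite -subn1 leq_subLR (leq_trans (leq_add sF (size_reciprocal D F))) //; lia.
  by rewrite andbT; lia.
- move=> z z1; rewrite QE // rmorphM rmorphXn /= [X in _ * (_ * X)]conj_Creal; last first.
    by rewrite gtr0_real // F2.
  by rewrite mulrA mul2n -addnn exprD -[_ * _ * _ ^+ D]mulrA -exprMn circle_mul_conj // expr1n mulr1.
- move=> z z1; rewrite QE //; apply: mulf_neq0; first exact/expf_neq0/circle_neq0.
  by rewrite gt_eqF ?F2.
have cG z : `|z| = 1 -> c * `|G.[z]| ^+ 2 = 1 - `|F.[z]| ^+ 2.
  move=> z1; apply: (mulfI (expf_neq0 D (circle_neq0 z1))).
  by rewrite -QE // GE //; ring.
(* The factorisation leaves [c] an arbitrary complex number; evaluation at 1 fixes its sign, so that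
   its square root can be absorbed into [G]. *)
have c0 : 0 <= c.
  have := F2 1 (normr1 _); rewrite -cG ?normr1 //.
  have [->|n0] := eqVneq `|G.[1]| 0; first by rewrite expr0n /= mulr0 ltxx.
  by rewrite pmulr_lgt0 ?exprn_gt0 ?lt_def ?n0 ?normr_ge0 // => /andP[].
exists (sqrtC c *: G); split; first by rewrite (leq_trans (size_scale_leq _ _)).
move=> z z1; rewrite hornerZ normrM exprMn ger0_norm ?sqrtC_ge0 // sqrtCK cG //.
by rewrite addrC subrK.
Qed.

(* Chooses the unit vector (x, y) orthogonal to the constant coefficients and
   aligned with the leading ones, which are orthogonal to each other. *)
Lemma deflate_pair D F G : (size F <= D.+2)%N -> (size G <= D.+2)%N ->
  (forall z, `|z| = 1 -> `|F.[z]| ^+ 2 + `|G.[z]| ^+ 2 = 1) ->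
  exists x y F' G', [/\ x * x^* + y * y^* = 1,
     (size F' <= D.+1)%N, (size G' <= D.+1)%N,
     F = x *: (F' * 'X) - y^* *: G' /\ G = y *: (F' * 'X) + x^* *: G' &
     forall z, `|z| = 1 -> `|F'.[z]| ^+ 2 + `|G'.[z]| ^+ 2 = 1].
Proof.
move=> sF sG FG.
(* On the circle |F|^2 + |G|^2 = 1 becomes a polynomial identity with right-hand side X^(D+1); this
   is its coefficient of degree 2D + 2. *)
have coef_orth : F`_D.+1 * (F`_0)^* + G`_D.+1 * (G`_0)^* = 0.
  have : F * reciprocal D.+1 F + G * reciprocal D.+1 G = 'X^(D.+1).
    apply: circle_ext => z z1; rewrite hornerD !hornerM !reciprocal_circle //.
    rewrite hornerXn -[RHS]mulr1 -(FG z z1) !normCK; ring.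
  move/(congr1 (fun p : {poly C} => p`_(D.+1 + D.+1))).
  have top (P P' : {poly C}) : (size P <= D.+2)%N -> (size P' <= D.+2)%N ->
     (P * P')`_(D.+1 + D.+1) = P`_D.+1 * P'`_D.+1.
    move=> sP sP'; rewrite coefM (bigD1 (Ordinal (leq_addr D.+1 D.+1 : D.+1 < (D.+1 + D.+1).+1)%N)) //=.
    rewrite addnK big1 ?addr0 // => k; rewrite -val_eqE /= => ne.
    have [lt|ge] := ltnP k D.+1.
      by rewrite [P'`__]nth_default ?mulr0 // (leq_trans sP') //; lia.
    by rewrite [P`__]nth_default ?mul0r // (leq_trans sP) //; lia.
  rewrite coefD !top ?size_reciprocal // !coef_poly ltnSn subnn coefXn => ->.
  by rewrite (_ : _ == _ = false) //; apply/negbTE; lia.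
have [x [y [xy1 b0 a0]]] : exists x y : C, [/\ x * x^* + y * y^* = 1,
    x^* * F`_0 + y^* * G`_0 = 0 & - y * F`_D.+1 + x * G`_D.+1 = 0].
  have normalize (a b : C) : (a != 0) || (b != 0) ->
      exists n, [/\ n != 0, n^* = n & n ^+ 2 * (a * a^* + b * b^*) = 1].
    move=> ab; have p : 0 < a * a^* + b * b^*.
      rewrite -!normCK; case/orP: ab => h.
        by rewrite ltr_wpDr ?exprn_ge0 // exprn_gt0 // normr_gt0.
      by rewrite ltr_wpDl ?exprn_ge0 // exprn_gt0 // normr_gt0.
    exists (sqrtC (a * a^* + b * b^*))^-1; split.
    - by rewrite invr_eq0 sqrtC_eq0 gt_eqF.
    - by rewrite conj_Creal // realV ger0_real // sqrtC_ge0 ltW.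
    - by rewrite exprVn sqrtCK mulVf // gt_eqF.
  (* Nonzero leading coefficients determine the direction, and [coef_orth] gives the other
     condition. If they vanish, the constant coefficients determine it; if these vanish too, any
     unit vector serves. *)
  case: (boolP ((F`_D.+1 != 0) || (G`_D.+1 != 0))) => [|/norP[/negPn/eqP a1 /negPn/eqP a2]].
    move=> /normalize[n [n0 nc n1]]; exists (n * F`_D.+1), (n * G`_D.+1).
    rewrite !rmorphM /= nc; split; [by rewrite -[RHS]n1; ring| |by ring].
    have := congr1 (fun w => n * w^*) coef_orth.
    by rewrite /= rmorphD !rmorphM /= !conjCK rmorph0 mulr0 => e; rewrite -[RHS]e; ring.
  case: (boolP ((F`_0 != 0) || (G`_0 != 0))) => [|/norP[/negPn/eqP b1 /negPn/eqP b2]].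
    move=> /normalize[n [n0 nc n1]]; exists (n * (G`_0)^*), (- n * (F`_0)^*).
    rewrite !rmorphM rmorphN /= nc !conjCK a1 a2; split; [|by ring|by ring].
    by rewrite -[RHS]n1; ring.
  by exists 1, 0; rewrite a1 a2 b1 b2 rmorph1 rmorph0; split; ring.
(* The pair rotated back: [H] loses its constant coefficient and [G'] its leading one, so dividing
   [H] by X lowers both degree bounds. *)
pose H := x^* *: F + y^* *: G; pose G' := (- y) *: F + x *: G.
have /factor_theorem[F' F'E] : root H 0.
  by rewrite /root horner_coef0 coefD !coefZ b0.
rewrite subr0 in F'E.
have FE : F = x *: (F' * 'X) - y^* *: G'.
  rewrite -[LHS]scale1r -xy1 -F'E /H /G' -!mul_polyC !(polyCD, polyCM, polyCN).
  by ring.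
have GE : G = y *: (F' * 'X) + x^* *: G'.
  rewrite -[LHS]scale1r -xy1 -F'E /H /G' -!mul_polyC !(polyCD, polyCM, polyCN).
  by ring.
have szle a b : (size (a *: F + b *: G)%R <= D.+2)%N.
  rewrite (leq_trans (size_polyD _ _)) // geq_max.
  by rewrite !(leq_trans (size_scale_leq _ _)).
exists x, y, F', G'; split => //.
- have := szle x^* y^*; rewrite -/H F'E.
  by have [->|nz] := eqVneq F' 0; rewrite ?size_poly0 // size_mulX.
- apply/leq_sizeP => j; rewrite leq_eqVlt => /orP[/eqP <-|jl].
    by rewrite coefD !coefZ a0.
  by move/leq_sizeP: (szle (- y) x); apply.
- move=> z z1; rewrite -[RHS](FG z z1).
  have -> : `|F'.[z]| ^+ 2 = `|H.[z]| ^+ 2 by rewrite F'E hornerMX normrM z1 mulr1.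
  rewrite /H /G' !(hornerD, hornerZ) !normCK !(rmorphD, rmorphM, rmorphN) /= !conjCK.
  transitivity ((x * x^* + y * y^*) * (F.[z] * F.[z]^* + G.[z] * G.[z]^*)); first by ring.
  by rewrite xy1 mul1r.
Qed.

End CirclePolynomials.

(** * A polynomial approximation of the inverse *)

Section Majority.
Variable R : realFieldType.

(* P(Bin(2l+1, q) > l) *)
Definition majority l (q : R) : R :=
  \sum_(k < (2 * l).+2 | (l < k)%N) q ^+ k * (1 - q) ^+ ((2 * l).+1 - k) *+ 'C((2 * l).+1, k).

Lemma majority_ge0 l q : 0 <= q <= 1 -> 0 <= majority l q.
Proof.
move=> /andP[q0 q1]; apply: sumr_ge0 => k _; rewrite mulrn_wge0 // mulr_ge0 ?exprn_ge0 //.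
by rewrite subr_ge0.
Qed.

(** An odd number of coins admits no tie, and exchanging heads with tails exchanges [q] with
    [1 - q]. *)
Lemma majorityC l q : majority l q + majority l (1 - q) = 1.
Proof.
have := exprDn (1 - q) q (2 * l).+1; rewrite subrK expr1n => B; rewrite [RHS]B.
rewrite [RHS](bigID (fun k : 'I_(2 * l).+2 => (l < k)%N)) /=; congr (_ + _).
  by apply: eq_bigr => k _; rewrite mulrC.
rewrite /majority (reindex_inj rev_ord_inj) /=; apply: eq_big => k.
  by have := ltn_ord k; lia.
move=> lk; rewrite (_ : 1 - (1 - q) = q); last by ring.
rewrite subSS (_ : _ - (_ - k) = k)%N; last by have := ltn_ord k; lia.
by rewrite bin_sub // -ltnS.
Qed.

(** For k > l, q^k (1-q)^(2l+1-k) is at most q^(l+1) (1-q)^l because q <= 1 - q, and all the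
    binomial coefficients together sum to 2^(2l+1). *)
Lemma majority_le l q : 0 <= q <= 1 / 2 ->
  majority l q <= 2 * q * (4 * q * (1 - q)) ^+ l.
Proof.
move=> /andP[q0 q1]; have q1' : 0 <= 1 - q by lra.
apply: (@le_trans _ _ (\sum_(k < (2 * l).+2) q ^+ l.+1 * (1 - q) ^+ l *+ 'C((2 * l).+1, k))).
  rewrite [leRHS](bigID (fun k : 'I_(2 * l).+2 => (l < k)%N)) /= ler_wpDr //.
    by apply: sumr_ge0 => k _; rewrite mulrn_wge0 // mulr_ge0 ?exprn_ge0.
  apply: ler_sum => k lk; rewrite lerMn2r; apply/orP; right.
  have [j kE] : exists j, (k = l.+1 + j :> nat)%N by exists (k - l.+1)%N; rewrite subnKC.
  have jl : (j <= l)%N by have := ltn_ord k; rewrite kE; lia.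
  rewrite kE (_ : _ - _ = l - j)%N; last by lia.
  rewrite exprD -[X in _ <= _ * (1 - q) ^+ X](subnK jl) [(1 - q) ^+ (_ + _)]exprD.
  rewrite -!mulrA [q ^+ j * _]mulrC; do 2 (rewrite ler_wpM2l ?exprn_ge0 //).
  by rewrite lerXn2r ?nnegrE //; lra.
have -> : \sum_(k < (2 * l).+2) q ^+ l.+1 * (1 - q) ^+ l *+ 'C((2 * l).+1, k)
   = q ^+ l.+1 * (1 - q) ^+ l * 2 ^+ (2 * l).+1.
  rewrite (_ : 2 = 1 + 1 :> R) ?exprDn ?mulr_sumr; last by ring.
  by apply: eq_bigr => k _; rewrite !expr1n mul1r mulr_natr.
rewrite [q ^+ _.+1]exprS [2 ^+ _.+1]exprS exprM !exprMn -exprMn (_ : 2 * 2 = 4 :> R); last by ring.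
by rewrite le_eqVlt; apply/orP; left; apply/eqP; ring.
Qed.

End Majority.

Section Filter.
Variable R : realFieldType.
Implicit Types (y : R) (n l : nat).

(* sin((2n+1)f) / sin f and cos((2n+1)f) / cos f as polynomials in (sin f)^2 *)
Fixpoint dirichlet n : {poly R} * {poly R} :=
  if n is n'.+1 then
    let DE := dirichlet n' in
    ((1 - 2 *: 'X) * DE.1 + (2 *: (1 - 'X)) * DE.2,
     (1 - 2 *: 'X) * DE.2 - (2 *: 'X) * DE.1)
  else (1, 1).

Local Notation D n y := ((dirichlet n).1.[y]).
Local Notation E n y := ((dirichlet n).2.[y]).

Lemma dirichletB y : (D 0 y = 1) * (E 0 y = 1).
Proof. by rewrite /= hornerC. Qed.

Lemma dirichletS n y :
  (D n.+1 y = (1 - 2 * y) * D n y + 2 * (1 - y) * E n y) *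
  (E n.+1 y = (1 - 2 * y) * E n y - 2 * y * D n y).
Proof. by rewrite /= !hornerE. Qed.

(** This is sin^2 + cos^2 = 1 at the angle (2n+1) f. *)
Lemma dirichlet_sqr n y : y * D n y ^+ 2 + (1 - y) * E n y ^+ 2 = 1.
Proof.
elim: n => [|n IH]; first by rewrite !dirichletB; ring.
by rewrite !dirichletS -[RHS]IH; ring.
Qed.

Lemma size_dirichlet n :
  (size (dirichlet n).1 <= n.+1)%N /\ (size (dirichlet n).2 <= n.+1)%N.
Proof.
have s1 (a b : R) : (size (a%:P + b *: 'X)%R <= 2)%N.
  rewrite (leq_trans (size_polyD _ _)) // geq_max (leq_trans (size_polyC_leq1 _)) //=.
  by rewrite (leq_trans (size_scale_leq _ _)) // size_polyX.
have e1 : 1 - 2 *: 'X = 1%:P + (-2) *: 'X :> {poly R} by rewrite scaleNr.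
have e2 : 2 *: (1 - 'X) = 2%:P + (-2) *: 'X :> {poly R}.
  by rewrite scalerBr scaleNr alg_polyC.
have e3 : 2 *: 'X = 0%:P + 2 *: 'X :> {poly R} by rewrite add0r.
elim: n => [|n [i1 i2]]; first by rewrite /= size_poly1.
have sM (p r : {poly R}) : (size p <= 2)%N -> (size r <= n.+1)%N -> (size (p * r)%R <= n.+2)%N.
  by move=> hp hr; rewrite (leq_trans (size_polyMleq _ _)) //; lia.
split; rewrite /= (leq_trans (size_polyD _ _)) // ?size_polyN geq_max !sM //.
- by rewrite e2.
- by rewrite e1.
- by rewrite e3.
- by rewrite e1.
Qed.

Local Notation N n := ((2 * n).+1%:R : R).

Lemma odd_natE n : N n = 2 * n%:R + 1.
Proof. by rewrite -natr1 natrM. Qed.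

Lemma odd_natS n : N n.+1 = N n + 2.
Proof. by rewrite mulnS -natrD; congr (_%:R); lia. Qed.

Lemma dirichlet0 n : D n 0 = N n.
Proof.
suff [] : D n 0 = N n /\ E n 0 = 1 by [].
elim: n => [|n [IH1 IH2]]; first by rewrite !dirichletB.
rewrite !dirichletS IH1 IH2; split; last by ring.
by rewrite odd_natS; ring.
Qed.

(** Each step of the recursion multiplies by cos 2f and adds 2 cos f cos((2n+1) f), so the absolute
    value grows by at most 2. *)
Lemma dirichlet_le n y : 0 <= y <= 1 -> `|D n y| <= N n.
Proof.
move=> y01; have y01' : 0 <= y <= 1 by [].
move/andP: y01' => [y0 y1].
elim: n => [|n IH]; first by rewrite dirichletB normr1.
have /= sq := dirichlet_sqr n y.
have G1 : `|(1 - y) * E n y| <= 1.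
  rewrite -(ler_pXn2r (_ : (0 < 2)%N)) ?nnegrE // expr1n real_normK ?num_real //.
  rewrite exprMn expr2 -mulrA mulr_ile1 //; try lra.
    by rewrite mulr_ge0 ?sqr_ge0 //; lra.
  by rewrite -[leRHS]sq lerDr mulr_ge0 ?sqr_ge0.
rewrite dirichletS (le_trans (ler_normD _ _)) // -mulrA normrM odd_natS.
rewrite [`|2 * _|]normrM [`|2|]ger0_norm //.
have h : `|1 - 2 * y| <= 1 by rewrite ler_norml; apply/andP; split; lra.
have := ler_pM (normr_ge0 _) (normr_ge0 _) h IH; rewrite mul1r => h2.
by apply: lerD => //; rewrite ler_piMr.
Qed.

(** The Taylor expansion of sin(N f) / sin f in y starts with N - N (N^2 - 1) y / 6; this truncation
    is already a lower bound, and N^2 - 1 is relaxed to N^2 at the end. *)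
Lemma dirichlet_ge n y : 0 <= y <= 1 -> N n * (1 - y * (N n ^+ 2) / 6) <= D n y.
Proof.
move=> y01; have /andP[y0 y1] := y01.
(* A lower bound for cos f cos((2k+1) f). Its deficit is quadratic in k, so summing it through the
   recursion for the first component produces k(k+1)(2k+1)/6, the sum of squares in [DE]. *)
have GE k : 1 - y - 2 * y * k%:R * k.+1%:R <= (1 - y) * E k y.
  elim: k => [|k IH]; first by rewrite !dirichletB; lra.
  have /= sq := dirichlet_sqr k y.
  have G1 : (1 - y) * E k y <= 1.
    rewrite (le_trans (ler_norm _)) //.
    rewrite -(ler_pXn2r (_ : (0 < 2)%N)) ?nnegrE // expr1n real_normK ?num_real //.
    rewrite exprMn expr2 -mulrA mulr_ile1 //; try lra.
      by rewrite mulr_ge0 ?sqr_ge0 //; lra.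
    by rewrite -[leRHS]sq lerDr mulr_ge0 ?sqr_ge0.
  rewrite !dirichletS.
  have /(le_trans (ler_norm _)) D1 := dirichlet_le k y01.
  have -> : (1 - y) * ((1 - 2 * y) * E k y - 2 * y * D k y) =
     (1 - 2 * y) * ((1 - y) * E k y) - 2 * y * ((1 - y) * D k y) by ring.
  move: G1 IH; set G := (1 - y) * _ => G1 IH.
  have y2 : 0 <= 2 * y by lra.
  have h1 : 2 * y * G <= 2 * y * 1 by apply: ler_wpM2l.
  have h2 : 2 * y * ((1 - y) * D k y) <= 2 * y * N k.
    apply: ler_wpM2l => //; have [d0|d0] := leP 0 (D k y); last first.
      by rewrite (@le_trans _ _ 0) // mulr_ge0_le0 //; lra.
    by rewrite (le_trans _ D1) // ler_piMl //; lra.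
  have Ek : 2 * y * (N k + 1) + 2 * y * k%:R * k.+1%:R = 2 * y * k.+1%:R * k.+2%:R.
    by rewrite odd_natE -[k.+2%:R]natr1 -[k.+1%:R]natr1; ring.
  lra.
have DE k : N k - 4 * y * (k%:R * k.+1%:R * (2 * k).+1%:R / 6) <= D k y.
  elim: k => [|k IH]; first by rewrite !dirichletB; lra.
  rewrite !dirichletS.
  have /(le_trans (ler_norm _)) D1 := dirichlet_le k y01.
  have h2 : 2 * y * D k y <= 2 * y * N k by apply: ler_wpM2l => //; lra.
  have := GE k; have := IH; have := h2.
  rewrite odd_natS !odd_natE -[k.+2%:R]natr1 -[k.+1%:R]natr1; set k' := k%:R : R.
  rewrite -[2 * (1 - y) * _]mulrA; set d := D k y; set e := (1 - y) * E k y => q1 q2 q3.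
  lra.
apply: le_trans (DE n); rewrite odd_natE -[n.+1%:R]natr1; set k := n%:R : R.
have k0 : 0 <= k by rewrite ler0n.
have : 0 <= y * (2 * k + 1) by rewrite mulr_ge0 //; lra.
nra.
Qed.

End Filter.

Lemma size_polyX_leq (F : nzRingType) (p : {poly F}) d k :
  (size p <= d.+1)%N -> (size (p ^+ k) <= (d * k).+1)%N.
Proof.
move=> h; elim: k => [|k IH]; first by rewrite expr0 muln0 size_poly1.
by rewrite exprS (leq_trans (size_polyMleq _ _)) //; lia.
Qed.

Section InverseFilter.
Variable R : realFieldType.

Definition fejer n : {poly R} := ((2 * n).+1%:R ^- 2) *: (dirichlet R n).1 ^+ 2.

Definition lowpass n l : {poly R} :=
  \sum_(k < (2 * l).+2 | (l < k)%N)
     fejer n ^+ k * (1 - fejer n) ^+ ((2 * l).+1 - k) *+ 'C((2 * l).+1, k).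

Lemma horner_fejer n y :
  (fejer n).[y] = ((dirichlet R n).1.[y] / (2 * n).+1%:R) ^+ 2.
Proof. by rewrite hornerZ horner_exp expr_div_n mulrC. Qed.

Lemma horner_lowpass n l y : (lowpass n l).[y] = majority l (fejer n).[y].
Proof.
rewrite /lowpass /majority horner_sum; apply: eq_bigr => k _.
by rewrite hornerMn hornerM !horner_exp hornerD hornerN hornerC.
Qed.

Lemma size_fejer n : (size (fejer n) <= (2 * n).+1)%N.
Proof.
rewrite (leq_trans (size_scale_leq _ _)) // expr2.
rewrite (leq_trans (size_polyMleq _ _)) //.
by have [h _] := size_dirichlet R n; lia.
Qed.

Lemma size_lowpass n l : (size (lowpass n l) <= (2 * n * (2 * l).+1).+1)%N.
Proof.
rewrite (leq_trans (size_sum _ _ _)) //; apply/bigmax_leqP => k _.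
rewrite -mulr_natl -polyC_natr mul_polyC (leq_trans (size_scale_leq _ _)) //.
rewrite (leq_trans (size_polyMleq _ _)) //.
have h1 := size_polyX_leq k (size_fejer n).
have h : (size (1 - fejer n)%R <= (2 * n).+1)%N.
  by rewrite (leq_trans (size_polyD _ _)) // size_polyN geq_max size_poly1 size_fejer.
have h2 := size_polyX_leq ((2 * l).+1 - k) h.
have -> : (2 * n * (2 * l).+1 = 2 * n * k + 2 * n * ((2 * l).+1 - k))%N.
  by rewrite -mulnDr subnKC // -ltnS ltn_ord.
by rewrite -subn1 leq_subLR add1n -addnS -addSn leq_add.
Qed.

Lemma fejer01 n y : 0 <= y <= 1 -> 0 <= (fejer n).[y] <= 1.
Proof.
move=> y01; rewrite horner_fejer sqr_ge0 /=.
rewrite -[leRHS](expr1n _ 2) -[leLHS]real_normK ?num_real //.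
rewrite lerXn2r ?nnegrE //; rewrite normrM normfV [`|_.+1%:R|]ger0_norm //.
by rewrite ler_pdivrMr ?ltr0Sn // mul1r dirichlet_le.
Qed.

Lemma lowpass0 n l : (lowpass n l).[0] = 1.
Proof.
rewrite horner_lowpass horner_fejer dirichlet0 divff ?pnatr_eq0 // expr1n.
have mC := majorityC l (1 : R); rewrite subrr in mC; rewrite -[RHS]mC.
suff -> : majority l (0 : R) = 0 by rewrite addr0.
apply/eqP; rewrite eq_le majority_ge0 ?lexx ?ler01 // andbT.
by rewrite (le_trans (majority_le l _)) ?lexx ?mulr0 ?mul0r //=; lra.
Qed.

(* With N beta = 8/5 the Fejer kernel crosses 1/2 strictly between 3 beta / 4 and
   beta, so that 1 - y t(y), its majority amplification, is exponentially small
   from beta on, while x t(x^2) = (1 - lowpass) / x never exceeds 4 / (3 beta). *)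
Lemma inverse_filter n l :
  let N := (2 * n).+1%:R : R in let beta := 8 / (5 * N) in
  exists t : {poly R},
  [/\ (size t <= 2 * n * (2 * l).+1)%N,
      forall y, y <= 1 -> beta ^+ 2 <= y -> `|1 - y * t.[y]| <= (975 / 1024) ^+ l
    & forall x, 0 <= x <= 1 -> 3 / 4 * beta * (x * `|t.[x ^+ 2]|) < 1].
Proof.
move=> N beta; have N0 : 0 < N by rewrite ltr0Sn.
have Nb : N * beta = 8 / 5.
  have gen (z : R) : 0 < z -> z * (8 / (5 * z)) = 8 / 5.
    by move=> z0; field; rewrite gt_eqF.
  exact: gen.
have b0 : 0 < beta by rewrite /beta divr_gt0 // mulr_gt0.
have [t tE] : exists t, 1 - lowpass n l = t * 'X.
  have /factor_theorem[t tE] : root (1 - lowpass n l) 0.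
    by rewrite /root hornerD hornerN hornerC lowpass0 subrr.
  by exists t; rewrite tE subr0.
have ht y : y * t.[y] = 1 - (lowpass n l).[y].
  by rewrite mulrC -hornerMX -tE hornerD hornerN hornerC.
exists t; split.
- have : (size (t * 'X)%R <= (2 * n * (2 * l).+1).+1)%N.
    rewrite -tE (leq_trans (size_polyD _ _)) // size_polyN geq_max size_poly1.
    exact: size_lowpass.
  by case: (eqVneq t 0) => [->|t0]; rewrite ?size_poly0 // size_mulX.
- move=> y y1 yb; have y0 : 0 < y by rewrite (lt_le_trans _ yb) // exprn_gt0.
  rewrite ht subKr horner_lowpass; set q := (fejer n).[y].
  have q01 : 0 <= q <= 1 by apply: fejer01; rewrite ltW.
  (* From y D^2 <= 1, y >= beta^2 and N beta = 8/5 follows q <= (5/8)^2. The rate is then 4 q (1 -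
     q) <= 4 (25/64) (39/64) = 975/1024. *)
  have q2 : q <= 25 / 64.
    rewrite /q horner_fejer expr_div_n ler_pdivrMr ?exprn_gt0 //.
    have := dirichlet_sqr n y; set D := (dirichlet R n).1.[y]; set E := (_).2.[y] => sq.
    have : 0 <= (1 - y) * E ^+ 2 by rewrite mulr_ge0 ?sqr_ge0 //; lra.
    have : beta ^+ 2 * D ^+ 2 <= y * D ^+ 2 by rewrite ler_wpM2r ?sqr_ge0.
    have -> : beta ^+ 2 = 64 / 25 / N ^+ 2.
      by rewrite -[beta](mulKf (lt0r_neq0 N0)) Nb exprMn exprVn mulrC; congr (_ / _); field.
    move=> h1 h2; have : y * D ^+ 2 <= 1 by lra.
    by move/(le_trans h1); rewrite mulrAC ler_pdivrMr ?exprn_gt0 // mul1r -/N; lra.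
  move/andP: q01 => [q0 q1].
  rewrite ger0_norm; last by apply: majority_ge0; rewrite q0.
  rewrite (le_trans (majority_le l _)) //; first by rewrite q0; lra.
  rewrite -[leRHS]mul1r ler_pM //; try lra.
    by rewrite exprn_ge0 // !mulr_ge0 //; lra.
  by rewrite lerXn2r ?nnegrE //; nra.
- move=> x /andP[x0 x1].
  have y01 : 0 <= x ^+ 2 <= 1 by rewrite sqr_ge0 exprn_ile1.
  have [->|xn0] := eqVneq x 0; first by rewrite mul0r mulr0 ltr01.
  have {xn0 x0}x0 : 0 < x by rewrite lt_neqAle eq_sym xn0.
  have hx : x * (x * `|t.[x ^+ 2]|) = `|1 - majority l (fejer n).[x ^+ 2]|.
    rewrite -horner_lowpass -ht normrM [`|x ^+ 2|]ger0_norm ?sqr_ge0 //.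
    by rewrite mulrA expr2.
  have := fejer01 n y01; set q := (fejer n).[_] in hx * => q01.
  have m0 := majority_ge0 l q01; have mC := majorityC l q.
  have m0' : 0 <= majority l (1 - q) by apply: majority_ge0; lra.
  have hx' : x * (x * `|t.[x ^+ 2]|) = majority l (1 - q).
    by rewrite hx -[1 in LHS]mC addrC addKr ger0_norm.
  set w := x * `|_| in hx' *.
  rewrite -(ltr_pM2l x0) mulr1 mulrCA hx'.
  (* Above 3 beta / 4 it is enough that a probability is at most 1. Below, N x <= 6/5 gives q >= 1/2
     and 1 - q <= (N x)^2 / 3, so the left side is at most (8/5) (6/5) / 2 = 24/25 times x. *)
  have [xb|xb] := leP x (3 / 4 * beta); last first.
    by apply: le_lt_trans xb; rewrite -[leRHS]mulr1 ler_wpM2l //; lra.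
  have Nx : N * x <= 6 / 5 by rewrite (le_trans (ler_wpM2l (ltW N0) xb)) //; lra.
  have Nx0 : 0 < N * x by rewrite mulr_gt0.
  have Dge := dirichlet_ge n y01.
  have qE : q = ((dirichlet R n).1.[x ^+ 2] / N) ^+ 2 by exact: horner_fejer.
  set s := _ / N in qE.
  have sge : 1 - (N * x) ^+ 2 / 6 <= s.
    rewrite /s ler_pdivlMr // (le_trans _ Dge) // /N exprMn.
    by rewrite le_eqVlt; apply/orP; left; apply/eqP; ring.
  set v := (N * x) in Nx Nx0 sge.
  have v2 : v ^+ 2 <= 36 / 25 by nra.
  have q1 : 1 - q <= v ^+ 2 / 3 by rewrite qE; nra.
  have q2 : 1 / 2 <= q by rewrite qE; nra.
  have : majority l (1 - q) <= 2 * (1 - q).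
    rewrite (le_trans (majority_le l _)) //; first lra.
    rewrite -[leRHS]mulr1 ler_wpM2l //; first lra.
    rewrite exprn_ile1 //; nra.
  move=> mm; apply: (@le_lt_trans _ _ (3 / 4 * beta * (2 * (v ^+ 2 / 3)))).
    by rewrite ler_wpM2l //; lra.
  have -> : 3 / 4 * beta * (2 * (v ^+ 2 / 3)) = (N * beta) * v * x / 2.
    have gen (a b c : R) : 3 / 4 * b * (2 * ((a * c) ^+ 2 / 3)) = a * b * (a * c) * c / 2.
      by field.
    exact: gen.
  rewrite Nb -[ltRHS]mul1r ltr_pdivrMr // -[ltRHS]mulrA [x * 2]mulrC mulrA mul1r.
  by rewrite ltr_pM2r // -[_ * N * x]mulrA -/v; lra.
Qed.

End InverseFilter.

(** * Signal processing in an algebra *)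

(* z^(2d+1) p((z + 1/z)/2) with z^2 replaced by z, where p(x) = x t(x^2) *)
Definition circle_lift (C : fieldType) d (t : {poly C}) : {poly C} :=
  \sum_(k < d.+1) t`_k *: ('X^(d - k) * (2^-1 *: ('X + 1)) ^+ (2 * k).+1).

Lemma size_circle_lift (C : fieldType) d (t : {poly C}) :
  (size (circle_lift d t) <= (2 * d).+2)%N.
Proof.
rewrite (leq_trans (size_sum _ _ _)) //; apply/bigmax_leqP => k _.
have kd : (k <= d)%N by rewrite -ltnS.
rewrite (leq_trans (size_scale_leq _ _)) // (leq_trans (size_polyMleq _ _)) //.
rewrite size_polyXn.
have : (size ((2^-1 *: ('X + 1)) ^+ (2 * k).+1 : {poly C}) <= (2 * k).+2)%N.
  have s2 : (size (2^-1 *: ('X + 1) : {poly C}) <= 2)%N.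
    by rewrite (leq_trans (size_scale_leq _ _)) // -polyC1 size_XaddC.
  by have := size_polyX_leq (2 * k).+1 s2; rewrite mul1n.
by move: (size _) => s hs; lia.
Qed.

(** Since (u^2 + 1) / 2 = u x, the term of index k carries u^(2(d-k)) (u x)^(2k+1), so the power of
    u is 2d+1 for every k. *)
Lemma circle_lift_sqr (C : numFieldType) d (t : {poly C}) u :
  (size t <= d.+1)%N -> u != 0 -> let x := 2^-1 * (u + u^-1) in
  (circle_lift d t).[u ^+ 2] = u ^+ (2 * d).+1 * (x * t.[x ^+ 2]).
Proof.
move=> st u0 x; rewrite horner_sum (horner_coef_wide _ st) !mulr_sumr.
apply: eq_bigr => k _; have kd : (k <= d)%N by rewrite -ltnS.
rewrite hornerZ hornerM hornerXn horner_exp hornerZ hornerD hornerX hornerC.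
have -> : 2^-1 * (u ^+ 2 + 1) = u * x.
  by rewrite /x [RHS]mulrCA [in RHS]mulrDr mulfV // expr2.
clearbody x; have -> : ((2 * d).+1 = 2 * (d - k) + (2 * k).+1)%N by lia.
by rewrite exprD -!exprM [(u * x) ^+ _]exprMn [x ^+ _.+1]exprS; ring.
Qed.

Section SignalProcessing.
Variables (C : numClosedFieldType) (A : algType C) (circ : nat -> A -> Prop).
Hypothesis circM : forall d d' W W', circ d W -> circ d' W' -> circ (d + d') (W * W').
Variable e : bool -> bool -> A.
Hypothesis eM : forall i j k l, e i j * e k l = if j == k then e i l else 0.
Hypothesis circ_rot : forall x y : C, x * x^* + y * y^* = 1 ->
  circ 1 (x *: e false false - y^* *: e false true + y *: e true false
          + x^* *: e true true).

Section Lift.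
Variables (Z : A) (g : nat).
Hypothesis eZ : forall i j, Z * e i j = e i j * Z.
Hypothesis circ_Z : circ g (e false false * Z + e true true).
Local Notation hZ := (horner_alg Z).

(** Only the first column of [W], seen as a 2 by 2 matrix over the algebra, is tracked: it is (F(Z),
    G(Z)). One deflation is a rotation times diag(Z, 1), because [F'] is multiplied by X and [G'] is
    not; it costs [g.+1] gates, and the constants left at degree 0 cost one more rotation. *)
Lemma signal_processing D (F G : {poly C}) : (size F <= D.+1)%N -> (size G <= D.+1)%N ->
  (forall z, `|z| = 1 -> `|F.[z]| ^+ 2 + `|G.[z]| ^+ 2 = 1) ->
  exists W, circ (D * g.+1).+1 W /\
    W * e false false = e false false * hZ F + e true false * hZ G.
Proof.
elim: D F G => [|D IH] F G sF sG FG.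
  exists (F`_0 *: e false false - (G`_0)^* *: e false true + G`_0 *: e true false
          + (F`_0)^* *: e true true); split.
    apply: circ_rot; have := FG 1 (normr1 _).
    by rewrite {1}(size1_polyC sF) {1}(size1_polyC sG) !hornerC !normCK.
  rewrite (size1_polyC sF) (size1_polyC sG) !coefC !eqxx !horner_algC !mulr_algr.
  by rewrite !mulrDl mulNr -!scalerAl !eM /= !scaler0 oppr0 !addr0.
have [x [y [F' [G' [xy sF' sG' [FE GE] FG']]]]] := deflate_pair sF sG FG.
have [W [cW WE]] := IH F' G' sF' sG' FG'.
exists ((x *: e false false - y^* *: e false true + y *: e true false
          + x^* *: e true true) * ((e false false * Z + e true true) * W)); split.
  have -> : ((D.+1 * g.+1).+1 = 1 + (g + (D * g.+1).+1))%N by lia.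
  by apply: circM; [exact: circ_rot|exact: circM].
rewrite -!mulrA WE.
have -> : (e false false * Z + e true true) * (e false false * hZ F' + e true false * hZ G')
    = e false false * hZ (F' * 'X) + e true false * hZ G'.
  rewrite mulrDr !mulrDl -![e false false * Z * _]mulrA ![Z * (_ * _)]mulrA !eZ !mulrA !eM /=.
  rewrite !mul0r addr0 add0r rmorphM /= horner_algX; congr (_ + _).
  rewrite -!mulrA; congr (_ * _).
  by rewrite -[X in X * _]horner_algX -[X in _ = _ * X]horner_algX -!rmorphM mulrC.
rewrite FE GE !(rmorphD, rmorphN) /= -!(mul_polyC) !rmorphM /= !horner_algC !mulr_algl.
rewrite horner_algX; set f := hZ F' * Z; set h := hZ G'.
rewrite !mulrDl !mulrDr !mulNr -!scalerAl !mulrA !eM /= !mul0r.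
rewrite !scaler0 !oppr0 !(addr0, add0r) !mulrN -!scalerAr [e false false * f]mulrA [e true false * f]mulrA.
by rewrite -!addrA.
Qed.

End Lift.

Variables (P r V Vi Hm Hd : A).
Hypotheses (VVi : V * Vi = 1) (ViV : Vi * V = 1) (PP : P * P = P) (rE : r = 2 *: P - 1).
Hypotheses (PVP : P * V * P = Hm * P) (PViP : P * Vi * P = Hd * P).
Hypotheses (PHm : P * Hm = Hm * P) (PHd : P * Hd = Hd * P).
Local Notation Z := (r * Vi * r * V).
Local Notation Zi := (Vi * r * V * r).

Lemma reflection_sqr : r * r = 1.
Proof.
rewrite rE mulrBl mul1r mulrBr mulr1 -scalerAl -scalerAr PP scalerA opprB -scalerBl.
rewrite (_ : 2 * 2 - 2 = 2 :> C); last by ring.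
by rewrite addrC subrK.
Qed.

Let reflK x : r * (r * x) = x. Proof. by rewrite mulrA reflection_sqr mul1r. Qed.
Let VViK x : V * (Vi * x) = x. Proof. by rewrite mulrA VVi mul1r. Qed.
Let ViVK x : Vi * (V * x) = x. Proof. by rewrite mulrA ViV mul1r. Qed.

Lemma walkK : Z * Zi = 1.
Proof. by rewrite -!mulrA VViK reflK ViVK reflection_sqr. Qed.

Lemma walkVK : Zi * Z = 1.
Proof. by rewrite -!mulrA reflK VViK reflK ViV. Qed.

Local Notation X1 := (2^-1 *: (r * Vi + Vi * r)).
Local Notation X2 := (2^-1 *: (r * V + V * r)).
Local Notation S := (2^-1 *: (Z + 1)).

Let half2 : 2^-1 * 2 = 1 :> C.
Proof. by rewrite mulVf // pnatr_eq0. Qed.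

(** As r P = P and r + 1 = 2 P, the average of [r * Vi] and [Vi * r] acts on the image of [P] as the
    compression P Vi P. *)
Lemma cosine_left : X1 * P = Hd * P.
Proof.
have rP : r * P = P.
  by rewrite rE mulrBl mul1r -scalerAl PP scaler_nat mulr2n addrK.
rewrite -scalerAl mulrDl -[Vi * r * P]mulrA rP rE mulrBl mul1r mulrBl.
by rewrite subrK -!scalerAl PViP scalerA half2 scale1r.
Qed.

Lemma cosine_right : X2 * P = Hm * P.
Proof.
have rP : r * P = P.
  by rewrite rE mulrBl mul1r -scalerAl PP scaler_nat mulr2n addrK.
rewrite -scalerAl mulrDl -[V * r * P]mulrA rP rE mulrBl mul1r mulrBl.
by rewrite subrK -!scalerAl PVP scalerA half2 scale1r.
Qed.

(** With [Z] in the role of u^2, [S] plays u x, while [Vi * r] removes one factor u and [Zi] two.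
    What remains is x, played by [X1], and x^2, played by [X1 * X2] in the next lemma. *)
Lemma half_walk_odd : S * (Vi * r) = X1.
Proof. by rewrite -scalerAl mulrDl mul1r -!mulrA VViK reflection_sqr mulr1. Qed.

Lemma half_walk_even : S * S * Zi = X1 * X2.
Proof.
rewrite -!scalerAl -!scalerAr -!scalerAl; congr (_ *: (_ *: _)).
have gen (z zi : A) : z * zi = 1 -> (z + 1) * (z + 1) * zi = z + 1 + (1 + zi).
  by move=> h; rewrite -mulrA [(z + 1) * zi]mulrDl h mul1r mulrDr mulr1 mulrDl mul1r h.
by rewrite gen ?walkK // mulrDl !mulrDr -!mulrA reflK ViVK ViV reflection_sqr.
Qed.

Lemma cosine_power k : (X1 * X2) ^+ k * X1 * P = (Hd * Hm) ^+ k * Hd * P.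
Proof.
elim: k => [|k IH]; first by rewrite !mul1r cosine_left.
rewrite !exprS -!mulrA in IH *; rewrite IH.
have -> : (Hd * Hm) ^+ k * (Hd * P) = P * ((Hd * Hm) ^+ k * Hd).
  have PHk : P * (Hd * Hm) ^+ k = (Hd * Hm) ^+ k * P.
    elim: k {IH} => [|k IH]; first by rewrite mulr1 mul1r.
    by rewrite !exprS !mulrA PHd -[Hd * P * Hm]mulrA PHm mulrA -mulrA IH !mulrA.
  by rewrite [RHS]mulrA PHk -mulrA PHd.
move: (_ ^+ k * Hd) => Y.
by rewrite [X2 * _]mulrA cosine_right -PHm -mulrA [X1 * _]mulrA cosine_left -mulrA [P * (Hm * _)]mulrA PHm -mulrA.
Qed.

(* X1 and X2 map the range of P into itself, where they act as Hd and Hm; all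
   the polynomial identities take place in the walk and hold before projecting. *)
Lemma qubitized_polynomial d (t : {poly C}) :
  horner_alg Z (circle_lift d t) * Zi ^+ d * (Vi * r) * P =
  (\sum_(k < d.+1) t`_k *: (Hd * Hm) ^+ k) * Hd * P.
Proof.
rewrite rmorph_sum !mulr_suml; apply: eq_bigr => k _.
rewrite -!mul_polyC !rmorphM /= horner_algC mulr_algl !rmorphXn rmorphM rmorphD rmorph1 /=.
rewrite horner_algX horner_algC mulr_algl.
rewrite -!scalerAl; congr (_ *: _); rewrite -cosine_power; congr (_ * _).
have kd : (k <= d)%N by rewrite -ltnS.
have cZ : GRing.comm Z Zi by rewrite /GRing.comm walkK walkVK.
have cS : GRing.comm S Zi.
  rewrite /GRing.comm -scalerAl -scalerAr mulrDl mulrDr mul1r mulr1; congr (_ *: (_ + _)).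
  exact: cZ.
have cSZ : GRing.comm S Z.
  by rewrite /GRing.comm -scalerAl -scalerAr mulrDl mulrDr mul1r mulr1.
have gen (z s zi zi' v : A) : z * s = s * z -> z * zi = 1 ->
    z * s * (zi * zi') * v = s * zi' * v.
  by move=> zs zz; rewrite zs !mulrA -[s * z * zi]mulrA zz mulr1.
(* Of the d inverse walks, d - k cancel the monomial Z^(d-k); the other k and the half step [Vi * r]
   turn S^(2k+1) into (X1 X2)^k X1. *)
rewrite -[X in Zi ^+ X](subnK kd) exprD gen; first last.
- by rewrite -exprMn_comm // walkK expr1n.
- exact/commrX/commr_sym/commrX.
rewrite [S ^+ _]exprSr exprM -[_ * S * Zi ^+ k]mulrA (commrX k cS) [_ * (_ * S)]mulrA -[_ * S * (Vi * r)]mulrA half_walk_odd.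
rewrite -exprMn_comm ?expr2 ?half_walk_even //.
by apply: commr_sym; apply: commrM; apply: commr_sym.
Qed.

(** The factor [Zi ^+ d * (Vi * r)], which strips the power u^(2d+1) from the lift, commutes with
    the control qubit and is therefore appended without control. *)
Lemma inversion_circuit g gi gv d (t : {poly C}) :
  (forall i j, V * e i j = e i j * V) -> (forall i j, Vi * e i j = e i j * Vi) ->
  (forall i j, P * e i j = e i j * P) ->
  circ g (e false false * Z + e true true) -> circ gi Zi -> circ gv (Vi * r) ->
  (forall z, `|z| = 1 -> `|(circle_lift d t).[z]| < 1) ->
  exists W, circ ((2 * d).+1 * g.+1 + 1 + d * gi + gv) W /\
    e false false * W * e false false * P =
    e false false * ((\sum_(k < d.+1) t`_k *: (Hd * Hm) ^+ k) * Hd * P).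
Proof.
move=> Ve Vie Pe cZ cZi cv F1.
have re i j : r * e i j = e i j * r.
  by rewrite rE mulrBl mulrBr mul1r mulr1 -scalerAl -scalerAr Pe.
have cc x y : (forall i j, x * e i j = e i j * x) -> (forall i j, y * e i j = e i j * y) ->
    forall i j, x * y * e i j = e i j * (x * y).
  by move=> hx hy i j; rewrite -mulrA hy mulrA hx mulrA.
have Ze : forall i j, Z * e i j = e i j * Z.
  exact: (cc _ _ (cc _ _ (cc _ _ re Vie) re) Ve).
have Zie : forall i j, Zi ^+ d * e i j = e i j * Zi ^+ d.
  elim: d {t F1} => [|d IH] i j; first by rewrite mul1r mulr1.
  rewrite exprS; apply: (cc _ _ _ IH); exact: (cc _ _ (cc _ _ (cc _ _ Vie re) Ve) re).
have vre : forall i j, Vi * r * e i j = e i j * (Vi * r).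
  exact: cc.
have [G [sG FG]] := complementary_polynomial (size_circle_lift d t) F1.
have [W [cW WE]] := signal_processing Ze cZ (size_circle_lift d t) sG FG.
have pw n W0 : circ n W0 -> circ (n + d * gi) (W0 * Zi ^+ d).
  move=> cW0; elim: d {t F1 sG FG WE cW Zie} => [|d IH]; first by rewrite mulr1 addn0.
  by rewrite mulSnr addnA exprSr mulrA; apply: circM.
exists (W * Zi ^+ d * (Vi * r)); split; first by apply: circM => //; rewrite addn1; apply: pw.
have -> : e false false * (W * Zi ^+ d * (Vi * r)) * e false false * P =
    e false false * (W * e false false) * (Zi ^+ d * (Vi * r) * P).
  rewrite -[RHS]mulrA -[W * e _ _ * _]mulrA ![e false false * (_ * P)]mulrA.
  by rewrite -(cc _ _ Zie vre) !mulrA.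
by rewrite WE -qubitized_polynomial mulrDr !mulrA !eM /= !mul0r addr0.
Qed.

End SignalProcessing.

(** The algebra structure is used on matrices whose size is a successor; the case analysis on [m]
    carries the result over to sizes such as [2 ^ N]. *)
Lemma inversion_circuit_mx (C : numClosedFieldType) m (circ : nat -> 'M[C]_m -> Prop)
    (e : bool -> bool -> 'M[C]_m) (P r V Vi Hm Hd : 'M[C]_m) g gi gv d (t : {poly C}) :
  (0 < m)%N ->
  (forall d d' W W', circ d W -> circ d' W' -> circ (d + d')%N (W *m W')) ->
  (forall i j k l, e i j *m e k l = if j == k then e i l else 0) ->
  (forall x y : C, x * x^* + y * y^* = 1 ->
    circ 1%N (x *: e false false - y^* *: e false true + y *: e true false
          + x^* *: e true true)) ->
  V *m Vi = 1%:M -> Vi *m V = 1%:M -> P *m P = P -> r = 2 *: P - 1%:M ->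
  P *m V *m P = Hm *m P -> P *m Vi *m P = Hd *m P ->
  P *m Hm = Hm *m P -> P *m Hd = Hd *m P ->
  (forall i j, V *m e i j = e i j *m V) -> (forall i j, Vi *m e i j = e i j *m Vi) ->
  (forall i j, P *m e i j = e i j *m P) ->
  circ g (e false false *m (r *m Vi *m r *m V) + e true true) ->
  circ gi (Vi *m r *m V *m r) -> circ gv (Vi *m r) ->
  (forall z, `|z| = 1 -> `|(circle_lift d t).[z]| < 1) ->
  exists W, circ ((2 * d).+1 * g.+1 + 1 + d * gi + gv)%N W /\
    e false false *m W *m e false false *m P =
    e false false *m ((\sum_(k < d.+1) t`_k *: (Hd *m Hm) ^+ k) *m Hd *m P).
Proof.
case: m circ e P r V Vi Hm Hd => // m circ e P r V Vi Hm Hd _ h1 h2 h3 h4 h5 h6 h7 h8 h9 h10 h11.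
move=> h12 h13 h14 h15 h16 h17 h18.
exact: (@inversion_circuit C 'M[C]_m.+1 circ h1 e h2 h3 P r V Vi Hm Hd h4 h5 h6 h7 h8 h9 h10 h11
  g gi gv d t h12 h13 h14 h15 h16 h17 h18).
Qed.

Local Open Scope complex_scope.
Local Open Scope sesquilinear_scope.

(** * Qubits *)

Lemma qubit_basis_state k (b : 'I_k -> bool) i : qubit (basis_state b) i = b i.
Proof.
rewrite /qubit /=; elim: k b i => [|k IH] b i; first by case: i.
rewrite big_ord_recl /= subn1 /=.
have tl : (\sum_(j < k) b (lift ord0 j) * 2 ^ (k.+1 - (bump 0 j).+1)
   = \sum_(j < k) b (lift ord0 j) * 2 ^ (k - j.+1))%N.
  by apply: eq_bigr => j _; rewrite /bump /= add1n subSS.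
rewrite tl.
have := basis_state_proof (fun j : 'I_k => b (lift ord0 j)).
set s := (\sum_(j < k) _)%N => lt_s.
case: (unliftP ord0 i) => [j|] ->; last first.
  rewrite /= subn1 /= divnMDl ?expn_gt0 // divn_small // addn0; by case: (b ord0).
rewrite /= /bump /= add1n subSS -(IH (fun j => b (lift ord0 j)) j) -/s.
have -> : (2 ^ k = 2 ^ (j.+1) * 2 ^ (k - j.+1))%N by rewrite -expnD subnKC.
rewrite mulnA divnMDl ?expn_gt0 // oddD expnS mulnCA mul2n odd_double.
by rewrite addFb.
Qed.

(** By counting: [basis_state] is injective between sets of 2^k elements, hence onto, so every index
    is determined by its bits. *)
Lemma qubit_inj k (x y : 'I_(2 ^ k)) : qubit x =1 qubit y -> x = y.
Proof.
have bij : bijective (fun f : {ffun 'I_k -> bool} => basis_state f).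
  apply: inj_card_bij; last by rewrite card_ffun card_bool !card_ord.
  move=> f g /= e; apply/ffunP => i.
  by rewrite -(qubit_basis_state f) e qubit_basis_state.
case: bij => g gK Kg e.
rewrite -(Kg x) -(Kg y); suff -> : g x = g y by []; apply/ffunP => i.
by rewrite -[LHS]qubit_basis_state Kg e -[in LHS](Kg y) qubit_basis_state.
Qed.

Lemma eq_basis_state k (b c : 'I_k -> bool) : b =1 c -> basis_state b = basis_state c.
Proof. by move=> e; apply: qubit_inj => i; rewrite !qubit_basis_state. Qed.

Section OnQubits.
Variable R : realType.
Local Notation C := R[i].

Definition agree_off N k (q : 'I_k -> 'I_N) (x y : 'I_(2 ^ N)) :=
  [forall i, (i \notin codom q) ==> (qubit x i == qubit y i)].

Definition restrict N k (q : 'I_k -> 'I_N) (x : 'I_(2 ^ N)) : 'I_(2 ^ k) :=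
  basis_state (fun j => qubit x (q j)).

Definition override N k (q : 'I_k -> 'I_N) (x : 'I_(2 ^ N)) (s : 'I_(2 ^ k)) :
    'I_(2 ^ N) :=
  basis_state (fun i => if [pick j | q j == i] is Some j then qubit s j
                        else qubit x i).

Lemma on_qubitsE N k (q : 'I_k -> 'I_N) (U : 'M[C]_(2 ^ k)) x y :
  on_qubits q U x y =
  if agree_off q x y then U (restrict q x) (restrict q y) else 0.
Proof. by rewrite mxE. Qed.

Lemma agree_offP N k (q : 'I_k -> 'I_N) x y :
  reflect (forall i, i \notin codom q -> qubit x i = qubit y i) (agree_off q x y).
Proof.
apply: (iffP forallP) => h i; first by move/(implyP (h i))/eqP.
by apply/implyP => /h /eqP.
Qed.

Lemma agree_off_sym N k (q : 'I_k -> 'I_N) x y :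
  agree_off q x y = agree_off q y x.
Proof. by apply/agree_offP/agree_offP => h i /h. Qed.

Lemma agree_off_trans N k (q : 'I_k -> 'I_N) x y z :
  agree_off q x y -> agree_off q y z = agree_off q x z.
Proof.
move/agree_offP => h; apply/agree_offP/agree_offP => h' i hi.
  by rewrite h // h'.
by rewrite -h // h'.
Qed.

Lemma qubit_override_off N k (q : 'I_k -> 'I_N) x s i :
  i \notin codom q -> qubit (override q x s) i = qubit x i.
Proof.
move=> hi; rewrite qubit_basis_state; case: pickP => // j /eqP e.
by rewrite -e codom_f in hi.
Qed.

Lemma qubit_override N k (q : 'I_k -> 'I_N) x s j :
  injective q -> qubit (override q x s) (q j) = qubit s j.
Proof.
move=> qi; rewrite qubit_basis_state; case: pickP => [j' /eqP/qi -> //|/(_ j)].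
by rewrite eqxx.
Qed.

Lemma restrict_override N k (q : 'I_k -> 'I_N) x s :
  injective q -> restrict q (override q x s) = s.
Proof.
by move=> qi; apply: qubit_inj => j; rewrite qubit_basis_state qubit_override.
Qed.

Lemma qubit_restrict N k (q : 'I_k -> 'I_N) x j :
  qubit (restrict q x) j = qubit x (q j).
Proof. exact: qubit_basis_state. Qed.

Lemma override_restrict N k (q : 'I_k -> 'I_N) x y :
  injective q -> agree_off q x y -> override q x (restrict q y) = y.
Proof.
move=> qi /agree_offP h; apply: qubit_inj => i.
case: (boolP (i \in codom q)) => [/codomP[j ->]|hi].
  by rewrite qubit_override // qubit_restrict.
by rewrite qubit_override_off // h.
Qed.

Lemma agree_off_override N k (q : 'I_k -> 'I_N) x s : agree_off q x (override q x s).
Proof. by apply/agree_offP => i hi; rewrite qubit_override_off. Qed.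

(** The intermediate states in a product of two gates on [q] are exactly the overrides of [x]; this
    turns the big matrix product into the small one. *)
Lemma sum_agree_off N k (q : 'I_k -> 'I_N) x (f : 'I_(2 ^ N) -> C) :
  injective q ->
  \sum_(w | agree_off q x w) f w = \sum_s f (override q x s).
Proof.
move=> qi; rewrite (reindex_onto (override q x) (restrict q)) /=; last first.
  by move=> w; apply: override_restrict.
by apply: eq_bigl => s; rewrite agree_off_override restrict_override ?eqxx.
Qed.

Lemma on_qubitsM N k (q : 'I_k -> 'I_N) (U V : 'M[C]_(2 ^ k)) :
  injective q -> on_qubits q U *m on_qubits q V = on_qubits q (U *m V).
Proof.
move=> qi; apply/matrixP => x y; rewrite mxE on_qubitsE.
rewrite (bigID (agree_off q x)) /= [X in _ + X]big1 ?addr0; last first.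
  by move=> w /negbTE hw; rewrite on_qubitsE hw mul0r.
rewrite sum_agree_off // mxE; case: ifPn => xy; last first.
  apply: big1 => s _; rewrite [X in _ * X]on_qubitsE.
  by rewrite (agree_off_trans y (agree_off_override q x s)) (negbTE xy) mulr0.
apply: eq_bigr => s _; rewrite !on_qubitsE agree_off_override.
by rewrite (agree_off_trans y (agree_off_override q x s)) xy restrict_override.
Qed.

Lemma on_qubits1 N k (q : 'I_k -> 'I_N) :
  injective q -> on_qubits q (1%:M : 'M[C]_(2 ^ k)) = 1%:M.
Proof.
move=> qi; apply/matrixP => x y; rewrite on_qubitsE !mxE.
case: (eqVneq x y) => [<-|ne]; last first.
  case: ifP => // xy; case: eqVneq => // e; case/eqP: ne.
  by rewrite -(override_restrict qi xy) -e override_restrict //; apply/agree_offP.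
by rewrite eqxx ifT //; apply/agree_offP.
Qed.

Lemma on_qubitsZ N k (q : 'I_k -> 'I_N) a (U : 'M[C]_(2 ^ k)) :
  on_qubits q (a *: U) = a *: on_qubits q U.
Proof. by apply/matrixP => x y; rewrite [RHS]mxE !on_qubitsE mxE; case: ifP; rewrite ?mulr0. Qed.

Lemma on_qubitsD N k (q : 'I_k -> 'I_N) (U V : 'M[C]_(2 ^ k)) :
  on_qubits q (U + V) = on_qubits q U + on_qubits q V.
Proof. by apply/matrixP => x y; rewrite [RHS]mxE !on_qubitsE mxE; case: ifP; rewrite ?addr0. Qed.

Lemma on_qubits_adj N k (q : 'I_k -> 'I_N) (U : 'M[C]_(2 ^ k)) :
  (on_qubits q U)^t* = on_qubits q (U^t*).
Proof.
apply/matrixP => x y; rewrite [LHS]mxE [X in Num.conj X]mxE !on_qubitsE agree_off_sym.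
by case: ifP; rewrite ?mxE ?rmorph0.
Qed.

Lemma on_qubits_unitary N k (q : 'I_k -> 'I_N) (U : 'M[C]_(2 ^ k)) :
  injective q -> U \is unitarymx -> on_qubits q U \is unitarymx.
Proof.
by move=> qi /unitarymxP uu; apply/unitarymxP; rewrite on_qubits_adj on_qubitsM // uu on_qubits1.
Qed.

(* Both orders of multiplication pass through a single intermediate state. *)
Lemma on_qubits_comm N k k' (q : 'I_k -> 'I_N) (q' : 'I_k' -> 'I_N)
    (U : 'M[C]_(2 ^ k)) (V : 'M[C]_(2 ^ k')) :
  injective q -> injective q' -> (forall i j, q i != q' j) ->
  on_qubits q U *m on_qubits q' V = on_qubits q' V *m on_qubits q U.
Proof.
move=> qi qi' dis; apply/matrixP => x y.
have off i : q i \notin codom q'.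
  by apply/negP => /codomP[j] e; move: (dis i j); rewrite e eqxx.
have off' i : q' i \notin codom q.
  by apply/negP => /codomP[j] e; move: (dis j i); rewrite e eqxx.
pose w1 := override q x (restrict q y); pose w2 := override q' x (restrict q' y).
have mulE k1 k2 (p : 'I_k1 -> 'I_N) (p' : 'I_k2 -> 'I_N) (U1 : 'M[C]_(2 ^ k1))
    (V1 : 'M[C]_(2 ^ k2)) : injective p -> injective p' ->
    (forall i, p i \notin codom p') -> (forall i, p' i \notin codom p) ->
    (on_qubits p U1 *m on_qubits p' V1) x y =
    if [forall i, (i \notin codom p) && (i \notin codom p') ==> (qubit x i == qubit y i)]
    then U1 (restrict p x) (restrict p y) * V1 (restrict p' x) (restrict p' y) else 0.
  move=> pI pI' o o'; rewrite mxE.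
  pose w := override p x (restrict p y).
  have rw : restrict p w = restrict p y by rewrite restrict_override.
  have rw' : restrict p' w = restrict p' x.
    by apply: eq_basis_state => j; rewrite qubit_override_off.
  have wu v : agree_off p x v -> agree_off p' v y -> v = w.
    move=> h /agree_offP h'; rewrite -(override_restrict pI h); congr override.
    by apply: eq_basis_state => j; rewrite h'.
  rewrite (bigD1 w) //= big1 ?addr0; last first.
    move=> v ne; rewrite !on_qubitsE; case: ifP => h; last by rewrite mul0r.
    case: ifP => h'; last by rewrite mulr0.
    by rewrite (wu v) ?eqxx in ne.
  rewrite !on_qubitsE agree_off_override rw rw'.
  have -> : agree_off p' w y = [forall i, (i \notin codom p) && (i \notin codom p')
      ==> (qubit x i == qubit y i)].
    apply/agree_offP/forallP => h i.
      by apply/implyP => /andP[h1 h2]; rewrite -(h i) // qubit_override_off.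
    move=> h2; case: (boolP (i \in codom p)) => [/codomP[j ->]|h1].
      by rewrite qubit_override // qubit_restrict.
    by rewrite qubit_override_off //; apply/eqP/(implyP (h i)); rewrite h1.
  by case: ifP; rewrite ?mulr0.
rewrite !mulE //; under [in RHS]eq_forallb do rewrite andbC.
by rewrite [in RHS]mulrC.
Qed.

End OnQubits.

(** * Adjoints, functional calculus and rotations *)

Section Adjoint.
Variable C : numClosedFieldType.

Lemma adjmxM m n p (A : 'M[C]_(m, n)) (B : 'M[C]_(n, p)) :
  (A *m B)^t* = B^t* *m A^t*.
Proof. by rewrite trmx_mul map_mxM. Qed.

Lemma adjmxD m n (A B : 'M[C]_(m, n)) : (A + B)^t* = A^t* + B^t*.
Proof. by rewrite linearD map_mxD. Qed.

Lemma adjmxN m n (A : 'M[C]_(m, n)) : (- A)^t* = - A^t*.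
Proof. by rewrite linearN /= map_mxN. Qed.

Lemma adjmxZ m n a (A : 'M[C]_(m, n)) : (a *: A)^t* = a^* *: A^t*.
Proof. by rewrite linearZ /= map_mxZ. Qed.

Lemma adjmx1 n : (1%:M : 'M[C]_n)^t* = 1%:M.
Proof. by rewrite trmx1 map_mx1. Qed.

Lemma unitary_bigprod n (s : seq 'M[C]_n) :
  {in s, forall G, G \is unitarymx} -> \big[mulmx/1%:M]_(G <- s) G \is unitarymx.
Proof.
elim: s => [|G s IH] h; first by rewrite big_nil; apply/unitarymxP; rewrite adjmx1 mulmx1.
rewrite big_cons; apply: mul_unitarymx; first by rewrite h ?mem_head.
by apply: IH => K Ks; rewrite h // in_cons Ks orbT.
Qed.

Lemma unitary_adjmul n (P : 'M[C]_n) : P \is unitarymx -> P^t* *m P = 1%:M.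
Proof.
move=> uP; have /unitarymxP : P^t* \is unitarymx by rewrite trmxC_unitary.
by rewrite trmxCK.
Qed.

Lemma unitary_diagX n (P : 'M[C]_n) (s : 'rV[C]_n) k : P \is unitarymx ->
  (P^t* *m diag_mx s *m P) ^+ k = P^t* *m diag_mx (\row_i s 0 i ^+ k) *m P.
Proof.
move=> uP; elim: k => [|k IH].
  rewrite expr0 (_ : \row_i _ = const_mx 1) ?diag_const_mx ?mulmx1 ?unitary_adjmul //.
  by apply/rowP => i; rewrite !mxE.
rewrite exprS IH -[LHS]/(_ *m _) !mulmxA -[P^t* *m _ *m P *m _]mulmxA (unitarymxP uP) mulmx1.
rewrite -[P^t* *m _ *m diag_mx _]mulmxA mulmx_diag; congr (_ *m diag_mx _ *m _).
by apply/rowP => i; rewrite !mxE exprS.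
Qed.

(** For [s] the eigenvalues of M^* M and [t] the coefficients of the filter, the diagonal entries
    are the scalar residuals 1 - y t(y). *)
Lemma unitary_diag_residual n (P : 'M[C]_n) (s : 'rV[C]_n) d (t : nat -> C) :
  P \is unitarymx ->
  1%:M - (\sum_(k < d) t k *: (P^t* *m diag_mx s *m P) ^+ k) *m (P^t* *m diag_mx s *m P) =
  P^t* *m diag_mx (\row_i (1 - s 0 i * \sum_(k < d) t k * s 0 i ^+ k)) *m P.
Proof.
move=> uP.
under eq_bigr => k _ do rewrite unitary_diagX // scalemxAl scalemxAr -linearZ /=.
rewrite -mulmx_suml -mulmx_sumr -linear_sum /= !mulmxA.
rewrite -[P^t* *m _ *m P *m _]mulmxA (unitarymxP uP) mulmx1.
rewrite -[P^t* *m _ *m diag_mx _]mulmxA mulmx_diag.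
have {1}-> : 1%:M = P^t* *m 1%:M *m P by rewrite mulmx1 unitary_adjmul.
rewrite -mulmxBl -mulmxBr; congr (_ *m _ *m _); rewrite -diag_const_mx -linearB /=.
congr diag_mx; apply/rowP => i; rewrite !mxE summxE mulrC; congr (_ - _ * _).
by apply: eq_bigr => k _; rewrite !mxE.
Qed.

Section Rotations.
Variables (n : nat) (f : bool -> bool -> 'M[C]_n).
Hypothesis fM : forall i j k l, f i j *m f k l = if j == k then f i l else 0.
Hypothesis f_adj : forall i j, (f i j)^t* = f j i.
Hypothesis f1 : f false false + f true true = 1%:M.
Local Notation rot x y := (x *: f false false - (Num.conj y) *: f false true
  + y *: f true false + (Num.conj x) *: f true true).

(** Having the form of a rotation, the inverse is again a single gate, so the adjoint of the LCU
    circuit costs no more than the circuit. *)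
Lemma rotation_adj x y : (rot x y)^t* = rot (Num.conj x) (- y).
Proof.
rewrite !(adjmxD, adjmxN, adjmxZ) !f_adj !conjCK rmorphN /=.
by rewrite !scaleNr opprK; congr (_ + _); rewrite addrAC.
Qed.

Lemma rotation_unitary x y : x * Num.conj x + y * Num.conj y = 1 -> rot x y \is unitarymx.
Proof.
move=> xy; apply/unitarymxP; rewrite !(adjmxD, adjmxN, adjmxZ) !f_adj !conjCK.
rewrite !(mulmxDl, mulmxDr, mulNmx, mulmxN) -!(scalemxAl, scalemxAr) !fM /=.
rewrite !(scaler0, oppr0, addr0, add0r, scalerA, opprK) -f1.
have -> : Num.conj y * y = 1 - x * Num.conj x by rewrite -xy; ring.
have -> : y * Num.conj y = 1 - x * Num.conj x by rewrite -xy; ring.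
by apply/matrixP => i j; rewrite !mxE; ring.
Qed.

End Rotations.

End Adjoint.

(** * Projectors onto fixed qubit values, and block-encodings as compressions *)

Section Projectors.
Variable R : realType.
Local Notation C := R[i].

Definition on_values N (S : {set 'I_N}) (b : 'I_N -> bool) (x : 'I_(2 ^ N)) :=
  [forall i in S, qubit x i == b i].

Definition qproj N (S : {set 'I_N}) (b : 'I_N -> bool) : 'M[C]_(2 ^ N) :=
  \matrix_(x, y) ((x == y) && on_values S b x)%:R.

Lemma qproj_mull N (S : {set 'I_N}) b k (M : 'M[C]_(2 ^ N, k)) x y :
  (qproj S b *m M) x y = if on_values S b x then M x y else 0.
Proof.
rewrite mxE (bigD1 x) //= big1 ?addr0.
  by rewrite mxE eqxx; case: ifP; rewrite ?mul1r ?mul0r.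
by move=> z ne; rewrite mxE eq_sym (negbTE ne) mul0r.
Qed.

Lemma qproj_mulr N (S : {set 'I_N}) b k (M : 'M[C]_(k, 2 ^ N)) x y :
  (M *m qproj S b) x y = if on_values S b y then M x y else 0.
Proof.
rewrite mxE (bigD1 y) //= big1 ?addr0.
  by rewrite mxE eqxx; case: ifP; rewrite ?mulr1 ?mulr0.
by move=> z ne; rewrite mxE (negbTE ne) mulr0.
Qed.

Lemma qprojE N (S : {set 'I_N}) b x y :
  qproj S b x y = if on_values S b x then (x == y)%:R else 0.
Proof. by rewrite mxE; case: ifP; rewrite (andbT, andbF). Qed.

Lemma qproj_idem N (S : {set 'I_N}) b : qproj S b *m qproj S b = qproj S b.
Proof.
by apply/matrixP => x y; rewrite qproj_mull !qprojE; case: (on_values S b x).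
Qed.

Lemma qproj_adj N (S : {set 'I_N}) b : (qproj S b)^t* = qproj S b.
Proof.
apply/matrixP => x y; rewrite !mxE rmorph_nat eq_sym.
by case: eqVneq => // ->.
Qed.

Lemma on_valuesU N (S T : {set 'I_N}) b x :
  on_values (S :|: T) b x = on_values S b x && on_values T b x.
Proof.
apply/forall_inP/andP => [h|[/forall_inP h /forall_inP h'] i].
  by split; apply/forall_inP => i hi; apply: h; rewrite inE hi ?orbT.
by rewrite inE => /orP[/h|/h'].
Qed.

Lemma qprojU N (S T : {set 'I_N}) b :
  qproj (S :|: T) b = qproj S b *m qproj T b.
Proof.
apply/matrixP => x y; rewrite qproj_mull !qprojE on_valuesU.
by case: (on_values S b x).
Qed.

Lemma qproj_comm_on_qubits N k (q : 'I_k -> 'I_N) (S : {set 'I_N}) b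
    (U : 'M[C]_(2 ^ k)) : (forall j, q j \notin S) ->
  qproj S b *m on_qubits q U = on_qubits q U *m qproj S b.
Proof.
move=> qS; apply/matrixP => x y; rewrite qproj_mull qproj_mulr on_qubitsE.
case: (boolP (agree_off q x y)) => xy; last by rewrite !if_same.
suff -> : on_values S b x = on_values S b y by [].
rewrite /on_values; apply: eq_forallb_in => i iS; move/agree_offP: xy => -> //.
by apply/negP => /codomP[j e]; move: (qS j); rewrite -e iS.
Qed.

Lemma controlledE N (S : {set 'I_N}) b (U : 'M[C]_(2 ^ N)) :
  controlled S b U = qproj S b *m U + (1%:M - qproj S b).
Proof.
apply/matrixP => x y; rewrite [LHS]mxE [RHS]mxE qproj_mull [X in _ + X]mxE.
rewrite [X in _ + (_ + X)]mxE qprojE [X in _ + (X + _)]mxE /on_values.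
by case: ifP => _; rewrite (subrr, subr0) ?addr0 ?add0r.
Qed.

Lemma controlled_adj N (S : {set 'I_N}) b (U : 'M[C]_(2 ^ N)) :
  qproj S b *m U = U *m qproj S b ->
  (controlled S b U)^t* = controlled S b (U^t*).
Proof.
move=> PU; by rewrite !controlledE PU !adjmxD adjmxN adjmx1 adjmxM qproj_adj.
Qed.

Lemma controlled_mul N (S : {set 'I_N}) b (U V : 'M[C]_(2 ^ N)) :
  qproj S b *m U = U *m qproj S b ->
  controlled S b U *m controlled S b V = controlled S b (U *m V).
Proof.
move=> PU; rewrite !controlledE.
have P2 := qproj_idem S b; set P := qproj S b in PU P2 *; set Q := 1%:M - P.
have PQ : P *m Q = 0 by rewrite mulmxBr P2 mulmx1 subrr.
have QP : Q *m P = 0 by rewrite mulmxBl P2 mul1mx subrr.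
have QQ : Q *m Q = Q by rewrite {1}/Q mulmxBl mul1mx PQ subr0.
clearbody Q.
have UV : P *m U *m (P *m V) = P *m (U *m V).
  by rewrite mulmxA -[P *m U *m P]mulmxA -PU mulmxA P2 mulmxA.
have UQ : P *m U *m Q = 0 by rewrite PU -mulmxA PQ mulmx0.
have QV : Q *m (P *m V) = 0 by rewrite mulmxA QP mul0mx.
by rewrite mulmxDl !mulmxDr UV UQ QV QQ addr0 add0r.
Qed.

Lemma controlled_unitary N (S : {set 'I_N}) b (U : 'M[C]_(2 ^ N)) :
  qproj S b *m U = U *m qproj S b -> U \is unitarymx ->
  controlled S b U \is unitarymx.
Proof.
move=> PU /unitarymxP uu; apply/unitarymxP.
rewrite controlled_adj // controlled_mul // uu controlledE mulmx1.
by rewrite addrC subrK.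
Qed.

(* the index of |0^m>|i> *)
Definition low0 n m (i : 'I_(2 ^ n)) : 'I_(2 ^ (m + n)) :=
  widen_ord (leq_pexp2l (isT : 0 < 2)%N (leq_addl m n)) i.

(** The ancillas are the leading qubits, so |0^m>|i> and |i> have the same number as index and the
    casts become invisible. *)
Lemma ket0_tensE m n x y : ket0_tens R m n x y = (x == low0 m y)%:R.
Proof.
rewrite /ket0_tens castmxE /= esymK.
set x' := cast_ord _ x; set y' := cast_ord _ y.
have ex : (x' : nat) = x by []. have ey : (y' : nat) = y by [].
case: (mxtens_indexP x') ex => x0 x1 ex.
case: (mxtens_indexP y') ey => y0 y1 ey.
rewrite tensmxE !mxE -natrM mulnb; congr (_%:R : C); congr nat_of_bool.
have y00 : (y0 : nat) = 0%N by case: (y0) => [[]].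
rewrite -!(inj_eq val_inj) /=; rewrite /= y00 mul0n add0n in ey.
rewrite -ex -ey /=.
apply/andP/eqP => [[/eqP -> /eqP ->]|e]; first by rewrite mul0n.
suff x00 : (x0 : nat) = 0%N by rewrite x00; move: e; rewrite x00 mul0n add0n => ->.
have := ltn_ord y1; have := ltn_ord x1.
case: (nat_of_ord x0) e => // k e _; rewrite -e mulSn -addnA.
by rewrite ltnNge leq_addr.
Qed.

Lemma ket0_block m n (U : 'M[C]_(2 ^ (m + n))) i j :
  ((ket0_tens R m n)^t* *m U *m ket0_tens R m n) i j = U (low0 m i) (low0 m j).
Proof.
rewrite mxE (bigD1 (low0 m j)) //= big1 ?addr0; last first.
  by move=> x ne; rewrite ket0_tensE (negbTE ne) mulr0.
rewrite ket0_tensE eqxx mulr1 mxE (bigD1 (low0 m i)) //= big1 ?addr0.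
  by rewrite mxE [X in Num.conj X]mxE ket0_tensE eqxx rmorph1 mul1r.
by move=> x ne; rewrite mxE [X in Num.conj X]mxE ket0_tensE (negbTE ne) rmorph0 mul0r.
Qed.

Lemma qubit_low0_lshift m n (i : 'I_(2 ^ n)) j : qubit (low0 m i) (lshift n j) = false.
Proof.
rewrite /qubit /= divn_small //; apply: (leq_trans (ltn_ord i)).
by rewrite leq_pexp2l //; have := ltn_ord j; lia.
Qed.

Lemma qubit_low0_rshift m n (i : 'I_(2 ^ n)) j : qubit (low0 m i) (rshift m j) = qubit i j.
Proof. by rewrite /qubit /= -addnS subnDl. Qed.

(** The wiring of an oracle: its ancillas go where [p] sends them among the [a] ancillas, its system
    qubits to the last [n] qubits. *)
Definition anc_reg a n m (p : 'I_m -> 'I_a) (j : 'I_(m + n)) : 'I_(a + n) :=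
  match fintype.split j with inl i => lshift n (p i) | inr i => rshift a i end.

Lemma anc_reg_inj a n m (p : 'I_m -> 'I_a) : injective p -> injective (@anc_reg a n m p).
Proof.
move=> pi j j'; rewrite /anc_reg -{2}(splitK j) -{2}(splitK j').
case: (fintype.split j) => i; case: (fintype.split j') => i' /=.
- by move/lshift_inj/pi => ->.
- by move/eqP; rewrite eq_lrshift.
- by move/eqP; rewrite eq_rlshift.
- by move/rshift_inj => ->.
Qed.

Lemma anc_reg_lshift a n m (p : 'I_m -> 'I_a) i :
  anc_reg p (lshift n i) = lshift n (p i).
Proof.
rewrite /anc_reg; case: splitP => [j /= e|j /= e].
  by congr (lshift _ (p _)); apply: val_inj.
by have := ltn_ord i; rewrite e ltnNge leq_addr.
Qed.

Lemma anc_reg_rshift a n m (p : 'I_m -> 'I_a) i :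
  anc_reg p (rshift m i) = rshift a i :> 'I_(a + n).
Proof.
rewrite /anc_reg; case: splitP => [j /= e|j /= /addnI e].
  by have := ltn_ord j; rewrite -e ltnNge leq_addr.
by congr rshift; apply: val_inj.
Qed.

Definition anc_set a n m (p : 'I_m -> 'I_a) : {set 'I_(a + n)} :=
  [set lshift n (p i) | i : 'I_m].

(** Block-encoding in projector form. Unlike a sandwich between kets it stays inside the full
    register, and so it can be combined with gates on other wires. *)
Lemma anc_block a n m (p : 'I_m -> 'I_a) (U : 'M[C]_(2 ^ (m + n))) :
  let P := qproj (anc_set n p) xpred0 in
  P *m on_qubits (anc_reg p) U *m P =
  P *m on_qubits (@rshift a n) ((ket0_tens R m n)^t* *m U *m ket0_tens R m n).
Proof.
move=> P; apply/matrixP => x y.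
rewrite qproj_mulr !qproj_mull; case: ifP => [yz|yz].
all: case: (boolP (on_values (anc_set n p) xpred0 x)) => xz; rewrite ?if_same // !on_qubitsE.
- have rE z : on_values (anc_set n p) xpred0 z ->
    restrict (anc_reg p) z = low0 m (restrict (@rshift a n) z).
    move=> /forall_inP zz; apply: qubit_inj => j; rewrite qubit_restrict.
    rewrite -(splitK j); case: (fintype.split j) => i /=.
      rewrite anc_reg_lshift qubit_low0_lshift; apply/eqP/zz.
      exact: imset_f.
    by rewrite anc_reg_rshift qubit_low0_rshift qubit_restrict.
  rewrite ket0_block -!rE //.
  suff -> : agree_off (anc_reg p) x y = agree_off (@rshift a n) x y by [].
  apply/agree_offP/agree_offP => h i hi.
    case: (boolP (i \in codom (@anc_reg a n m p))) => [/codomP[j ej]|]; last exact: h.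
    move: hi; rewrite ej -(splitK j); case: (fintype.split j) => j' /=.
      rewrite anc_reg_lshift => _.
      move/forall_inP: xz => /(_ (lshift n (p j')) (imset_f _ isT))/eqP ->.
      by move/forall_inP: yz => /(_ (lshift n (p j')) (imset_f _ isT))/eqP ->.
    by rewrite anc_reg_rshift codom_f.
  apply: h; apply: contra hi => /codomP[j ->].
  by rewrite -(anc_reg_rshift p j) codom_f.
- case: ifP => // /agree_offP h; case/negP: yz.
  apply/forall_inP => i /imsetP[j _ ->]; rewrite -h.
    by move/forall_inP: xz; apply; exact: imset_f.
  by apply/negP => /codomP[j' /eqP]; rewrite eq_lrshift.
Qed.

Lemma sys_block a n (S : {set 'I_(a + n)}) (M : 'M[C]_(2 ^ n)) :
  (forall i, rshift a i \notin S) ->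
  (ket0_tens R a n)^t* *m (qproj S xpred0 *m on_qubits (@rshift a n) M)
    *m ket0_tens R a n = M.
Proof.
move=> hS; apply/matrixP => i j; rewrite ket0_block qproj_mull on_qubitsE.
have r k : restrict (@rshift a n) (low0 a k) = k.
  by apply: qubit_inj => l; rewrite qubit_restrict qubit_low0_rshift.
rewrite !r ifT; last first.
  apply/forall_inP => l; rewrite -(splitK l); case: (fintype.split l) => l' /=.
    by rewrite qubit_low0_lshift.
  by rewrite (negbTE (hS l')).
rewrite ifT //; apply/agree_offP => l; rewrite -(splitK l); case: (fintype.split l) => l' /=.
  by rewrite !qubit_low0_lshift.
by rewrite codom_f.
Qed.

Lemma qproj_ket0 a n (S : {set 'I_(a + n)}) :
  (forall i, rshift a i \notin S) ->
  qproj S xpred0 *m ket0_tens R a n = ket0_tens R a n.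
Proof.
move=> hS; apply/matrixP => x y; rewrite qproj_mull ket0_tensE.
case: ifP => // /negP h; case: eqP => // e; case: h; rewrite e.
apply/forall_inP => l; rewrite -(splitK l); case: (fintype.split l) => l' /=.
  by rewrite qubit_low0_lshift.
by rewrite (negbTE (hS l')).
Qed.

End Projectors.

(** * Norms and singular values *)

Section Norms.
Variable R : realType.
Local Notation C := R[i].
Local Notation normc := ComplexField.Normc.normc.
Implicit Types (m n p : nat).

Lemma normcC (x : C) : (normc x)%:C = `|x|.
Proof. by case: x => a b; rewrite normc_def. Qed.

Lemma normc_real (x : R) : normc x%:C = `|x|.
Proof. by rewrite /= expr0n /= addr0 sqrtr_sqr. Qed.

Lemma l2norm_ge0 m (v : 'cV[C]_m) : 0 <= l2norm v.
Proof. exact: sqrtr_ge0. Qed.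

Lemma l2norm_sqr m (v : 'cV[C]_m) :
  (l2norm v ^+ 2)%:C = (v^t* *m v) 0 0.
Proof.
rewrite sqr_sqrtr; last by apply: sumr_ge0 => i _; rewrite sqr_ge0.
rewrite rmorph_sum mxE; apply: eq_bigr => i _.
by rewrite rmorphXn /= normcC normCK !mxE mulrC.
Qed.

Lemma l2norm_eq m p (v : 'cV[C]_m) (w : 'cV[C]_p) :
  (v^t* *m v) 0 0 = (w^t* *m w) 0 0 -> l2norm v = l2norm w.
Proof.
rewrite -!l2norm_sqr => /(congr1 (@complex.Re _)) /= e.
by apply/eqP; rewrite -(@eqrXn2 _ 2) ?l2norm_ge0 // e.
Qed.

Lemma l2norm_eq0 m (v : 'cV[C]_m) : l2norm v = 0 -> v = 0.
Proof.
move=> /eqP; rewrite sqrtr_eq0 => h.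
have /eqP : \sum_i normc (v i 0) ^+ 2 = 0.
  by apply/eqP; rewrite eq_le h sumr_ge0 // => i _; rewrite sqr_ge0.
rewrite psumr_eq0; last by move=> i _; rewrite sqr_ge0.
move=> /allP hi; apply/colP => i; rewrite mxE.
apply: ComplexField.Normc.eq0_normc; apply/eqP; rewrite -sqrf_eq0.
by apply: hi; rewrite mem_index_enum.
Qed.

Lemma l2norm0 m : l2norm (0 : 'cV[C]_m) = 0.
Proof.
rewrite /l2norm big1 ?sqrtr0 // => i _.
by rewrite mxE ComplexField.Normc.normc0 expr0n.
Qed.

Lemma l2normZ m a (v : 'cV[C]_m) : l2norm (a *: v) = normc a * l2norm v.
Proof.
have -> : normc a = Num.sqrt (normc a ^+ 2).
  by rewrite sqrtr_sqr ger0_norm //; case: a => x y; rewrite sqrtr_ge0.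
rewrite /l2norm -sqrtrM ?sqr_ge0 //; congr Num.sqrt; rewrite mulr_sumr.
by apply: eq_bigr => i _; rewrite mxE ComplexField.Normc.normcM exprMn.
Qed.

Lemma l2normN m (v : 'cV[C]_m) : l2norm (- v) = l2norm v.
Proof. by apply: l2norm_eq; rewrite adjmxN mulNmx mulmxN opprK. Qed.

Lemma l2normD m (v w : 'cV[C]_m) : l2norm (v + w) <= l2norm v + l2norm w.
Proof.
have dE (u : 'cV[C]_m) : sqrtC (dotmx u^T u^T) = (l2norm u)%:C.
  rewrite dotmxE.
  have -> : (u^T *m (u^T)^t* ) 0 0 = ((l2norm u)%:C) ^+ 2.
    rewrite -rmorphXn /= l2norm_sqr !mxE; apply: eq_bigr => i _.
    by rewrite !mxE mulrC.
  by rewrite sqrCK // ler0c l2norm_ge0.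
have [h _] := triangle_lerif (@dotmx C m) v^T w^T.
have e : v^T + w^T = (v + w)^T by rewrite linearD.
rewrite -lecR rmorphD -[X in X <= _]dE -e.
by apply: le_trans h _; rewrite !dE.
Qed.

Lemma l2norm_unitary m (U : 'M[C]_m) (v : 'cV[C]_m) :
  U \is unitarymx -> l2norm (U *m v) = l2norm v.
Proof.
move=> uU; apply: l2norm_eq; rewrite adjmxM -mulmxA [U^t* *m _]mulmxA.
have /unitarymxP : U^t* \is unitarymx by rewrite trmxC_unitary.
by rewrite trmxCK => ->; rewrite mul1mx.
Qed.

Lemma l2norm_isometry m p (T : 'M[C]_(m, p)) (v : 'cV[C]_p) :
  T^t* *m T = 1%:M -> l2norm (T *m v) = l2norm v.
Proof.
by move=> TT; apply: l2norm_eq; rewrite adjmxM -mulmxA [T^t* *m _]mulmxA TT mul1mx.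
Qed.

(** Pythagoras: the difference of the squared norms is the squared norm of w - T T^* w. *)
Lemma l2norm_coisometry m p (T : 'M[C]_(m, p)) (w : 'cV[C]_m) :
  T^t* *m T = 1%:M -> l2norm (T^t* *m w) <= l2norm w.
Proof.
move=> TT; rewrite -(@ler_pXn2r _ 2) ?nnegrE ?l2norm_ge0 // -lecR.
pose z := w - T *m (T^t* *m w).
rewrite !l2norm_sqr -subr_ge0.
suff -> : (w^t* *m w) 0 0 - ((T^t* *m w)^t* *m (T^t* *m w)) 0 0 = (l2norm z ^+ 2)%:C.
  by rewrite ler0c sqr_ge0.
rewrite l2norm_sqr /z; set y := T^t* *m w.
have yE : y^t* = w^t* *m T by rewrite adjmxM trmxCK.
have Ty : T^t* *m w = y by []; clearbody y.
rewrite adjmxD adjmxN adjmxM mulmxBl !mulmxBr [w^t* *m (T *m y)]mulmxA -yE.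
rewrite -[y^t* *m T^t* *m w]mulmxA Ty -[y^t* *m T^t* *m _]mulmxA [T^t* *m (T *m y)]mulmxA.
by rewrite TT mul1mx subrr subr0 [RHS]mxE [X in _ = _ + X]mxE.
Qed.

Lemma ket0_tens_isometry m n : (ket0_tens R m n)^t* *m ket0_tens R m n = 1%:M.
Proof.
have := @ket0_block R m n 1%:M; rewrite mulmx1 => h.
by apply/matrixP => i j; rewrite h !mxE.
Qed.

Lemma l2norm_sum m (I : finType) (f : I -> 'cV[C]_m) :
  l2norm (\sum_i f i) <= \sum_i l2norm (f i).
Proof.
elim/big_rec2 : _ => [|i x y _ h]; first by rewrite l2norm0.
by rewrite (le_trans (l2normD _ _)) // lerD2l.
Qed.

Lemma l2norm_coord m (v : 'cV[C]_m) i : normc (v i 0) <= l2norm v.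
Proof.
rewrite -(@ler_pXn2r _ 2) ?nnegrE ?l2norm_ge0 //; last first.
  by case: (v i 0) => x y; rewrite sqrtr_ge0.
rewrite sqr_sqrtr; last by apply: sumr_ge0 => j _; rewrite sqr_ge0.
by rewrite (bigD1 i) //= lerDl sumr_ge0 // => j _; rewrite sqr_ge0.
Qed.

(** A real [sup] is informative only on a bounded set; the sum of the column norms is a crude bound,
    each coordinate of a unit vector being at most 1. *)
Lemma opnorm_bounded m p (M : 'M[C]_(m, p)) :
  has_ubound [set l2norm (M *m v) | v in [set v : 'cV[C]_p | l2norm v = 1]]%classic.
Proof.
exists (\sum_j l2norm (col j M)) => _ [v /= v1 <-].
have -> : M *m v = \sum_j v j 0 *: col j M.
  apply/colP => i; rewrite mxE summxE; apply: eq_bigr => j _.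
  by rewrite !mxE mulrC.
rewrite (le_trans (l2norm_sum _)) //; apply: ler_sum => j _.
rewrite l2normZ -[leRHS]mul1r ler_wpM2r ?l2norm_ge0 //.
by rewrite -v1 l2norm_coord.
Qed.

Lemma l2norm_le_opnorm m p (M : 'M[C]_(m, p)) v :
  l2norm (M *m v) <= opnorm M * l2norm v.
Proof.
have [v0|v0] := eqVneq (l2norm v) 0.
  by rewrite (l2norm_eq0 v0) mulmx0 !l2norm0 mulr0.
pose u := (l2norm v)^-1%:C *: v.
have u1 : l2norm u = 1.
  by rewrite l2normZ normc_real ger0_norm ?invr_ge0 ?l2norm_ge0 // mulVf.
have : l2norm (M *m u) <= opnorm M.
  by apply: (ub_le_sup (opnorm_bounded M)); exists u.
rewrite -scalemxAr l2normZ normc_real ger0_norm ?invr_ge0 ?l2norm_ge0 //.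
by rewrite mulrC ler_pdivrMr // lt_def v0 l2norm_ge0.
Qed.

Lemma unit_vector m : (0 < m)%N -> exists v : 'cV[C]_m, l2norm v = 1.
Proof.
case: m => // m _; exists (delta_mx 0 0).
apply/eqP; rewrite -(@eqrXn2 _ 2) ?l2norm_ge0 // expr1n; apply/eqP.
rewrite sqr_sqrtr; last by apply: sumr_ge0 => i _; rewrite sqr_ge0.
rewrite (bigD1 0) //= big1 ?addr0; last first.
  by move=> i /negbTE i0; rewrite mxE i0 ComplexField.Normc.normc0 expr0n.
by rewrite mxE !eqxx ComplexField.Normc.normc1 expr1n.
Qed.

Lemma opnorm_ge0 m p (M : 'M[C]_(m, p)) : (0 < p)%N -> 0 <= opnorm M.
Proof.
move=> /unit_vector[v v1]; rewrite (le_trans (l2norm_ge0 (M *m v))) //.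
by rewrite (le_trans (l2norm_le_opnorm _ _)) // v1 mulr1.
Qed.

Lemma opnorm_le m p (M : 'M[C]_(m, p)) c : (0 < p)%N ->
  (forall v, l2norm (M *m v) <= c * l2norm v) -> opnorm M <= c.
Proof.
move=> p0 h; apply: ge_sup.
  by have [v v1] := unit_vector p0; exists (l2norm (M *m v)), v.
by move=> _ [v /= v1 <-]; rewrite (le_trans (h v)) // v1 mulr1.
Qed.

Lemma opnorm_le0 m p (M : 'M[C]_(m, p)) : opnorm M <= 0 -> M = 0.
Proof.
move=> M0; apply/matrixP => i j.
suff -> : M i j = (M *m delta_mx j (0 : 'I_1)) i 0.
  rewrite (_ : _ *m _ = 0) ?mxE //; apply: l2norm_eq0; apply/eqP.
  rewrite eq_le l2norm_ge0 andbT (le_trans (l2norm_le_opnorm _ _)) //.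
  by rewrite mulr_le0_ge0 ?l2norm_ge0.
by rewrite -colE mxE.
Qed.

Lemma exact_encoding m n alpha (U : 'M[C]_(2 ^ (m + n))) (M : 'M[C]_(2 ^ n)) :
  block_encoding alpha 0 U M ->
  M = alpha%:C *: ((ket0_tens R m n)^t* *m U *m ket0_tens R m n).
Proof. by case=> _ /opnorm_le0/eqP; rewrite subr_eq0 => /eqP. Qed.

Lemma block_contraction m n (U : 'M[C]_(2 ^ (m + n))) v : U \is unitarymx ->
  l2norm (((ket0_tens R m n)^t* *m U *m ket0_tens R m n) *m v) <= l2norm v.
Proof.
move=> uU; rewrite -!mulmxA.
rewrite (le_trans (l2norm_coisometry _ (ket0_tens_isometry m n))) //.
by rewrite l2norm_unitary // l2norm_isometry // ket0_tens_isometry.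
Qed.

End Norms.

(** * Singular values *)

Section SingularValues.
Variable R : realType.
Local Notation C := R[i].

(** Spectral theorem for the Hermitian matrix X^* X. The rows w of [P] are unit left eigenvectors,
    and the eigenvalue of w is the squared norm of X w^*, hence a square of a nonnegative real. *)
Lemma gram_spectral m (X : 'M[C]_m) : exists (P : 'M[C]_m) (s : 'I_m -> R),
  [/\ P \is unitarymx, forall i, singular_value X (s i) &
      X^t* *m X = P^t* *m diag_mx (\row_i (s i ^+ 2)%:C) *m P].
Proof.
set H := X^t* *m X.
have Hh : H \is hermsymmx.
  by apply/is_hermitianmxP; rewrite expr0 scale1r /H adjmxM trmxCK.
have /orthomx_spectralP := hermitian_normalmx Hh.
have := hermitian_spectral_diag_real Hh; have uP := spectral_unitarymx H.
rewrite invmx_unitary //; set P := spectralmx H in uP *; set d := spectral_diag H.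
move=> dr HE.
have PH : P *m H = diag_mx d *m P.
  by rewrite HE !mulmxA (unitarymxP uP) mul1mx.
have rowE i : row i P *m H = d 0 i *: row i P.
  by rewrite -row_mul PH row_mul row_diag_mx -scalemxAl -rowE.
have nrow i : row i P *m (row i P)^t* = 1%:M.
  apply/matrixP => a b; rewrite !ord1 !mxE eqxx.
  have /matrixP/(_ i i) := unitarymxP uP; rewrite !mxE eqxx => <-.
  by apply: eq_bigr => k _; rewrite !mxE.
have dE i : exists s, 0 <= s /\ d 0 i = (s ^+ 2)%:C.
  exists (l2norm (X *m (row i P)^t* )); split; first exact: l2norm_ge0.
  rewrite l2norm_sqr adjmxM trmxCK mulmxA -[row i P *m _ *m X]mulmxA rowE.
  by rewrite -scalemxAl nrow !mxE mulr1.
have [s sE] : exists s : 'I_m -> R, forall i, 0 <= s i /\ d 0 i = (s i ^+ 2)%:C.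
  exists (fun i => projT1 (cid (dE i))) => i; exact: (projT2 (cid (dE i))).
exists P, s; split => //; last first.
  by rewrite HE; congr (_ *m diag_mx _ *m _); apply/rowP => i; rewrite mxE; case: (sE i).
move=> i; case: (sE i) => s0 di; split=> //; apply/eigenvalueP; exists (row i P).
  by rewrite rowE di.
apply/eqP => r0; have := nrow i; rewrite r0 mul0mx => /matrixP/(_ 0 0).
by rewrite !mxE eqxx => /eqP; rewrite eq_sym oner_eq0.
Qed.

Lemma sigma_min_le m (X : 'M[C]_m) s : singular_value X s -> sigma_min X <= s.
Proof. by move=> sX; apply: ge_inf => //; exists 0 => t []. Qed.

Lemma singular_vector m (X : 'M[C]_m) s : singular_value X s ->
  exists v : 'cV[C]_m, l2norm v != 0 /\ l2norm (X *m v) = s * l2norm v.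
Proof.
move=> [s0 /eigenvalueP[w wE w0]]; exists (w^t* ); split.
  apply: contra w0 => /eqP/l2norm_eq0/(congr1 (fun u : 'cV[C]_m => u^t* )).
  by rewrite trmxCK => ->; rewrite trmx0 map_mx0.
apply/eqP; rewrite -(@eqrXn2 _ 2) ?mulr_ge0 ?l2norm_ge0 // exprMn; apply/eqP.
have h : (l2norm (X *m w^t* ) ^+ 2)%:C = (s ^+ 2)%:C * (l2norm (w^t* ) ^+ 2)%:C :> C.
  apply: (etrans (l2norm_sqr _)).
  rewrite adjmxM !trmxCK mulmxA -[w *m _ *m X]mulmxA wE -scalemxAl mxE; congr (_ * _).
  by apply/esym/(etrans (l2norm_sqr _)); rewrite trmxCK.
by move: h; rewrite -rmorphM => /(congr1 (@complex.Re _)).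
Qed.

Lemma sigma_min_ge m (X : 'M[C]_m) c : (0 < m)%N ->
  (forall v, c * l2norm v <= l2norm (X *m v)) -> c <= sigma_min X.
Proof.
move=> m0 h; apply: lb_le_inf.
  by have [P [s [_ sX _]]] := gram_spectral X; exists (s (Ordinal m0)); exact: sX.
move=> s /singular_vector[v [v0 vE]]; have := h v; rewrite vE ler_pM2r //.
by rewrite lt_def v0 l2norm_ge0.
Qed.

(** The inverse of X = I + A^-1 B is (A + B)^-1 A = I - (A + B)^-1 B, and its norm is bounded by the
    triangle inequality. *)
Lemma sigma_min_bound m (A B : 'M[C]_m) : (0 < m)%N ->
  A \in unitmx -> A + B \in unitmx ->
  0 < 1 / (1 + opnorm (invmx (A + B)) * opnorm B) <= sigma_min (1%:M + invmx A *m B).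
Proof.
move=> m0 uA uAB; set c := 1 + _.
have c0 : 0 < c by rewrite ltr_pwDl // mulr_ge0 ?opnorm_ge0.
rewrite divr_gt0 //=; apply: sigma_min_ge => // v.
rewrite mul1r mulrC ler_pdivrMr //; set X := _ + _.
have AX : A *m X = A + B by rewrite mulmxDr mulmx1 mulKVmx.
have e : X - invmx (A + B) *m (B *m X) = 1%:M.
  apply: (can_inj (mulKmx uAB)).
  by rewrite mulmxBr mulKVmx // mulmx1 mulmxDl AX addrK.
have vE : v = X *m v - invmx (A + B) *m (B *m (X *m v)).
  by rewrite -[LHS]mul1mx -e mulmxBl !mulmxA.
rewrite {1}vE (le_trans (l2normD _ _)) // -[X in _ <= X]mulrC mulrDl mul1r lerD2l //.
rewrite l2normN (le_trans (l2norm_le_opnorm _ _)) // -mulrA ler_wpM2l ?opnorm_ge0 //.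
exact: l2norm_le_opnorm.
Qed.

Lemma sigma_min_upper m (X : 'M[C]_m) c : (0 < m)%N ->
  (forall v, l2norm (X *m v) <= c * l2norm v) -> sigma_min X <= c.
Proof.
move=> m0 h; have [P [s [_ sX _]]] := gram_spectral X.
have [v [v0 vE]] := singular_vector (sX (Ordinal m0)).
rewrite (le_trans (sigma_min_le (sX (Ordinal m0)))) //.
by have := h v; rewrite vE ler_pM2r // lt_def v0 l2norm_ge0.
Qed.

End SingularValues.

(** * From scalar bounds on the filter to matrices *)

Section InversionError.
Variable R : realType.
Local Notation C := R[i].

(** For z = u^2 on the circle, (u + 1/u) / 2 is the real part of u, which lies in [-1, 1]; as x
    t(x^2) is odd, the bound on [0, 1] is enough. *)
Lemma circle_lift_lt1 d c (t : {poly R}) : (size t <= d.+1)%N -> 0 < c ->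
  (forall x, 0 <= x <= 1 -> c * (x * `|t.[x ^+ 2]|) < 1) ->
  forall z : C, `|z| = 1 ->
    `|(circle_lift d (map_poly (real_complex R) (c *: t))).[z]| < 1.
Proof.
move=> st c0 ht z z1; pose u := sqrtC z.
have u2 : u ^+ 2 = z by rewrite sqrtCK.
have u1 : `|u| = 1.
  by apply/eqP; rewrite -(@pexpr_eq1 _ _ 2) // -normrX u2 z1.
rewrite -u2 circle_lift_sqr ?circle_neq0 //; last first.
  by rewrite size_map_inj_poly ?rmorph0 ?(leq_trans (size_scale_leq _ _)) //; exact: complexI.
rewrite normrM normrX u1 expr1n mul1r -(circle_conj u1).
have [a [a1 ->]] : exists a : R, `|a| <= 1 /\ 2^-1 * (u + u^*) = a%:C.
  move: u1; case: u {u2} => a b u1; exists a; split; last first.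
    have -> : (a +i* b + (a +i* b)^*)%C = 2 * a%:C.
      apply/eqP; rewrite mulr_natl mulr2n eq_complex /=; apply/andP.
      by split; apply/eqP; ring.
    by rewrite mulrA mulVf ?mul1r // pnatr_eq0.
  move: u1; rewrite normc_def => /(congr1 (@complex.Re _)) /= s1.
  rewrite -[leRHS]s1 -sqrtr_sqr ler_wsqrtr // lerDl sqr_ge0 //.
rewrite -rmorphXn horner_map /= -rmorphM normc_def /= expr0n addr0 sqrtr_sqr.
rewrite ltcR hornerZ mulrCA !normrM (gtr0_norm c0).
by have := ht `|a|; rewrite real_normK ?num_real // normr_ge0 => ->.
Qed.

Lemma unitary_diag_norm m (P : 'M[C]_m) (s : 'rV[C]_m) eps v : P \is unitarymx ->
  (forall i, ComplexField.Normc.normc (s 0 i) <= eps) ->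
  l2norm (P^t* *m diag_mx s *m P *m v) <= eps * l2norm v.
Proof.
move=> uP hs; rewrite -!mulmxA l2norm_unitary ?trmxC_unitary // -[in leRHS](l2norm_unitary v uP).
set w := P *m v.
have [e0|e0] := leP 0 eps; last first.
  have -> : w = 0.
    apply/colP => i; have := le_lt_trans (hs i) e0; case: (s 0 i) => a b /=.
    by rewrite ltNge sqrtr_ge0.
  by rewrite mulmx0 !l2norm0 mulr0.
have -> : eps = Num.sqrt (eps ^+ 2) by rewrite sqrtr_sqr ger0_norm.
rewrite /l2norm -sqrtrM ?sqr_ge0 // ler_wsqrtr // mulr_sumr; apply: ler_sum => i _.
rewrite mul_diag_mx mxE ComplexField.Normc.normcM exprMn ler_wpM2r ?sqr_ge0 //.
by rewrite lerXn2r ?nnegrE //; case: (s 0 i) => a b; rewrite sqrtr_ge0.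
Qed.

(** The two norm bounds place all singular values of [M] in [beta, 1], where the filter is accurate;
    diagonalising M^* M reduces the rest to scalars. *)
Lemma inversion_residual m (M : 'M[C]_m) d (t : {poly R}) beta eps :
  (size t <= d.+1)%N -> 0 < beta ->
  (forall v, l2norm (M *m v) <= l2norm v) ->
  (forall v, beta * l2norm v <= l2norm (M *m v)) ->
  (forall y, y <= 1 -> beta ^+ 2 <= y -> `|1 - y * t.[y]| <= eps) ->
  forall v, l2norm ((1%:M - (\sum_(k < d.+1) (t`_k)%:C *: (M^t* *m M) ^+ k)
                     *m (M^t* *m M)) *m v) <= eps * l2norm v.
Proof.
move=> st b0 Mle Mge ht v.
have [P [s [uP sM HE]]] := gram_spectral M.
have s1 i : 0 <= s i /\ beta <= s i <= 1.
  have [s0 _] := sM i; have [w [w0 wE]] := singular_vector (sM i).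
  have w0' : 0 < l2norm w by rewrite lt_def w0 l2norm_ge0.
  split=> //; have := Mle w; have := Mge w; rewrite wE ler_pM2r // => ->.
  by rewrite -{2}[l2norm w]mul1r ler_pM2r.
have -> : 1%:M - (\sum_(k < d.+1) (t`_k)%:C *: (M^t* *m M) ^+ k) *m (M^t* *m M) =
    P^t* *m diag_mx (\row_i (1 - s i ^+ 2 * t.[s i ^+ 2])%:C) *m P.
  pose D : 'rV[C]_m := \row_i (s i ^+ 2)%:C; rewrite -/D in HE.
  have DE : \row_i (1 - s i ^+ 2 * t.[s i ^+ 2])%:C =
      \row_i (1 - D 0 i * \sum_(k < d.+1) (t`_k)%:C * D 0 i ^+ k) :> 'rV[C]_m.
    apply/rowP => i; rewrite !mxE (horner_coef_wide _ st).
    have -> : \sum_(k < d.+1) (t`_k)%:C * (s i ^+ 2)%:C ^+ k =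
        (\sum_(k < d.+1) t`_k * (s i ^+ 2) ^+ k)%:C :> C.
      by rewrite rmorph_sum; apply: eq_bigr => k _; rewrite -rmorphXn -rmorphM.
    by rewrite -rmorphM -(rmorph1 (real_complex R)) -rmorphB.
  rewrite DE HE; exact: unitary_diag_residual D d.+1 (fun k => (t`_k)%:C) uP.
apply: unitary_diag_norm => // i; rewrite mxE normc_real.
have [s0 /andP[sb s1i]] := s1 i.
by apply: ht; rewrite ?exprn_ile1 // lerXn2r ?nnegrE // ltW.
Qed.

End InversionError.

(** * Circuits *)

Section OneQubit.
Variable R : realType.
Local Notation C := R[i].

Definition bit (b : bool) : 'I_(2 ^ 1) := basis_state (fun _ : 'I_1 => b).

Lemma bit_inj : injective bit.
Proof. by move=> b b' /(congr1 (fun x => qubit x ord0)); rewrite !qubit_basis_state. Qed.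

Lemma bitE (x : 'I_(2 ^ 1)) : x = bit (qubit x ord0).
Proof. by apply: qubit_inj => i; rewrite qubit_basis_state ord1. Qed.

Definition munit (i j : bool) : 'M[C]_(2 ^ 1) := delta_mx (bit i) (bit j).

Lemma munitM i j k l : munit i j *m munit k l = if j == k then munit i l else 0.
Proof. by rewrite mul_delta_mx_cond (inj_eq bit_inj); case: eqP. Qed.

Lemma munit1 : munit false false + munit true true = 1%:M.
Proof.
apply/matrixP => x y; rewrite !mxE (bitE x) (bitE y) !(inj_eq bit_inj).
by case: (qubit x _); case: (qubit y _); rewrite ?addr0 ?add0r.
Qed.

Lemma munit_adj i j : (munit i j)^t* = munit j i.
Proof. by apply/matrixP => x y; rewrite !mxE rmorph_nat andbC. Qed.

Definition rotmx (x y : C) : 'M[C]_(2 ^ 1) :=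
  x *: munit false false - y^* *: munit false true + y *: munit true false
  + x^* *: munit true true.

Lemma rotmx_unitary x y : x * x^* + y * y^* = 1 -> rotmx x y \is unitarymx.
Proof. exact: rotation_unitary munitM munit_adj munit1 _ _. Qed.

Lemma rotmx_adj x y : (rotmx x y)^t* = rotmx (Num.conj x) (- y).
Proof. exact: rotation_adj munit_adj _ _. Qed.

Variable N : nat.

Lemma one_qubit_inj (c : 'I_N) : injective (fun _ : 'I_1 => c).
Proof. by move=> i j; rewrite !ord1. Qed.

Definition qunit (c : 'I_N) i j : 'M[C]_(2 ^ N) := on_qubits (fun=> c) (munit i j).

Lemma on_qubits0 k (q : 'I_k -> 'I_N) : on_qubits q (0 : 'M[C]_(2 ^ k)) = 0.
Proof. by rewrite -(scale0r (0 : 'M[C]_(2 ^ k))) on_qubitsZ scale0r. Qed.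

Lemma qunitM c i j k l : qunit c i j *m qunit c k l = if j == k then qunit c i l else 0.
Proof.
rewrite /qunit on_qubitsM ?munitM; last exact: one_qubit_inj.
by case: eqP; rewrite ?on_qubits0.
Qed.

Lemma qunit1 c : qunit c false false + qunit c true true = 1%:M.
Proof. by rewrite -on_qubitsD munit1 on_qubits1 //; exact: one_qubit_inj. Qed.

Lemma qunit_qproj c b : qproj R [set c] b = qunit c (b c) (b c).
Proof.
apply/matrixP => x y; rewrite /qunit on_qubitsE qprojE mxE.
have rE z : restrict (fun _ : 'I_1 => c) z = bit (qubit z c) by [].
have -> : on_values [set c] b x = (qubit x c == b c).
  apply/forall_inP/eqP => [h|h i]; first by apply/eqP/h; rewrite set11.
  by move/set1P => ->; apply/eqP.
rewrite !rE !(inj_eq bit_inj).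
case: eqVneq => [xc|xc] /=; last by rewrite if_same.
have -> : (x == y) = agree_off (fun _ : 'I_1 => c) x y && (qubit y c == b c).
  apply/eqP/andP => [<-|[/agree_offP h /eqP yc]].
    by rewrite xc eqxx; split => //; apply/agree_offP.
  apply: qubit_inj => i; have [->|ic] := eqVneq i c; first by rewrite xc yc.
  by apply: h; apply: contra ic => /codomP[_ ->].
by case: ifP.
Qed.

Lemma rot_qunit c x y : on_qubits (fun=> c) (rotmx x y) =
  x *: qunit c false false - y^* *: qunit c false true + y *: qunit c true false
  + x^* *: qunit c true true.
Proof. by rewrite !on_qubitsD -scaleNr !on_qubitsZ scaleNr. Qed.

Lemma qunit_comm k (q : 'I_k -> 'I_N) c (U : 'M[C]_(2 ^ k)) i j :
  injective q -> (forall l, q l != c) ->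
  on_qubits q U *m qunit c i j = qunit c i j *m on_qubits q U.
Proof. by move=> qi qc; apply: on_qubits_comm => //; exact: one_qubit_inj. Qed.

Lemma qproj_qunit_comm (S : {set 'I_N}) b c i j : c \notin S ->
  qproj R S b *m qunit c i j = qunit c i j *m qproj R S b.
Proof. by move=> cS; apply: qproj_comm_on_qubits. Qed.

Lemma qproj_set0 b : qproj R (finset.set0 : {set 'I_N}) b = 1%:M.
Proof.
apply/matrixP => x y; rewrite qprojE !mxE ifT //.
by apply/forall_inP => i; rewrite inE.
Qed.

Lemma controlled_set0 b (U : 'M[C]_(2 ^ N)) : controlled (finset.set0 : {set 'I_N}) b U = U.
Proof. by rewrite controlledE qproj_set0 mul1mx subrr addr0. Qed.

Section Circuits.
Variables (kA kB : nat) (UA : 'M[C]_(2 ^ kA)) (UB : 'M[C]_(2 ^ kB)).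
Local Notation circ := (@circuit_with R N kA kB UA UB).

Lemma circuit_mul d d' W W' : circ d W -> circ d' W' -> circ (d + d') (W *m W').
Proof.
move=> [gs [hgs ->]] [gs' [hgs' ->]].
exists [tuple of gs ++ gs']; split; last first.
  suff gen (s s' : seq 'M[C]_(2 ^ N)) : \big[mulmx/1%:M]_(G <- s) G *m \big[mulmx/1%:M]_(G <- s') G
      = \big[mulmx/1%:M]_(G <- s ++ s') G by exact: gen.
  elim: s => [|G s IH]; first by rewrite big_nil mul1mx.
  by rewrite cat_cons !big_cons -mulmxA IH.
move=> i; have : tnth [tuple of gs ++ gs'] i \in gs ++ gs' := mem_tnth i [tuple of gs ++ gs'].
by rewrite mem_cat => /orP[/tnthP[j ->]|/tnthP[j ->]].
Qed.

Lemma circuit_gate G :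
  [\/ application UA G, application UB G | primitive_gate G] -> circ 1 G.
Proof.
move=> hG; exists [tuple G]; split; first by move=> i; rewrite ord1.
by rewrite /= big_cons big_nil mulmx1.
Qed.

Hypotheses (uA : UA \is unitarymx) (uB : UB \is unitarymx).

Lemma application_unitary k (U : 'M[C]_(2 ^ k)) (G : 'M[C]_(2 ^ N)) : U \is unitarymx ->
  application U G -> G \is unitarymx.
Proof.
move=> uU [V q S VU qi _ qS].
apply: controlled_unitary; first exact: qproj_comm_on_qubits.
apply: (on_qubits_unitary qi).
by case: VU => ->; rewrite ?invmx_unitary ?trmxC_unitary.
Qed.

Lemma circuit_unitary d W : circ d W -> W \is unitarymx.
Proof.
move=> [gs [hgs ->]].
apply: unitary_bigprod.
move=> G /tnthP[i ->]; case: (hgs i).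
- exact: application_unitary.
- exact: application_unitary.
- case=> V q S b uV qS; apply: controlled_unitary.
    by apply: qproj_comm_on_qubits.
  by apply: on_qubits_unitary uV; exact: one_qubit_inj.
Qed.

Lemma circuit_one_qubit c (S : {set 'I_N}) b (V : 'M[C]_(2 ^ 1)) :
  V \is unitarymx -> c \notin S -> circ 1 (controlled S b (on_qubits (fun=> c) V)).
Proof. by move=> uV cS; apply/circuit_gate/Or33; exact: PrimitiveGate. Qed.

Lemma circuit_rot c x y : x * x^* + y * y^* = 1 ->
  circ 1 (x *: qunit c false false - y^* *: qunit c false true + y *: qunit c true false
  + x^* *: qunit c true true).
Proof.
move=> xy; rewrite -rot_qunit -[on_qubits _ _](controlled_set0 xpred0).
by apply: circuit_one_qubit; [exact: rotmx_unitary|rewrite inE].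
Qed.

(** The gate -1 on a qubit [c] outside [S], controlled on zeros in [S], is 1 - 2P; a second gate -1
    corrects the sign, hence two gates. *)
Lemma circuit_reflection c (S : {set 'I_N}) : c \notin S ->
  circ 2 (2 *: qproj R S xpred0 - 1%:M).
Proof.
move=> cS; set P := qproj R S xpred0.
have uN : (- 1%:M : 'M[C]_(2 ^ 1)) \is unitarymx.
  by apply/unitarymxP; rewrite adjmxN adjmx1 mulNmx mulmxN opprK mulmx1.
have oN : on_qubits (fun _ : 'I_1 => c) (- 1%:M : 'M[C]_(2 ^ 1)) = - 1%:M.
  by rewrite -scaleN1r on_qubitsZ on_qubits1 ?scaleN1r //; exact: one_qubit_inj.
have -> : 2 *: P - 1%:M = - 1%:M *m controlled S xpred0 (- 1%:M).
  rewrite controlledE -/P mulNmx mul1mx mulmxN mulmx1 opprD opprK opprB addrA.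
  by rewrite scaler_nat mulr2n.
apply: (circuit_mul (d := 1) (d' := 1)).
  by rewrite -oN -[on_qubits _ _](controlled_set0 xpred0); apply: circuit_one_qubit; rewrite ?inE.
by rewrite -oN; exact: circuit_one_qubit.
Qed.

(** Let D = diag(-1, 1) on [c]. The product of D with its version controlled by [S] is D^2 = 1 on
    the image of P and D on the complement: this is 2P - 1 where [c] is 0 and the identity where [c]
    is 1. *)
Lemma circuit_controlled_reflection c (S : {set 'I_N}) : c \notin S ->
  circ 2 (qunit c false false *m (2 *: qproj R S xpred0 - 1%:M) + qunit c true true).
Proof.
move=> cS; have PP := qproj_idem R S xpred0.
have Pe i j := qproj_qunit_comm xpred0 i j cS.
set P := qproj R S xpred0 in PP Pe *.
pose D := munit true true - munit false false.
have uD : D \is unitarymx.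
  apply/unitarymxP; rewrite adjmxD adjmxN !munit_adj.
  rewrite !(mulmxDl, mulmxDr, mulNmx, mulmxN) !munitM /=.
  by rewrite !(oppr0, addr0, add0r, opprK) addrC munit1.
have oD : on_qubits (fun _ : 'I_1 => c) D = qunit c true true - qunit c false false.
  by rewrite on_qubitsD -scaleN1r on_qubitsZ scaleN1r.
have -> : qunit c false false *m (2 *: P - 1%:M) + qunit c true true =
   on_qubits (fun=> c) D *m controlled S xpred0 (on_qubits (fun=> c) D).
  rewrite controlledE -/P oD; have := qunit1 c.
  have e00 := qunitM c false false false false. have e01 := qunitM c false false true true.
  have e10 := qunitM c true true false false. have e11 := qunitM c true true true true.
  move: Pe => /(_ false false); move: e00 e01 e10 e11 => /=.
  set x := qunit c false false; set y := qunit c true true => e00 e01 e10 e11 Px xy.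
  have DD : (y - x) *m (y - x) = 1%:M.
    by rewrite !(mulmxDl, mulmxDr, mulNmx, mulmxN) e00 e01 e10 e11 !(oppr0, addr0, add0r) opprK addrC.
  have yE : y = 1%:M - x by rewrite -xy addrC addKr.
  have DP : (y - x) *m P = P *m (y - x).
    by rewrite yE !(mulmxBl, mulmxBr) mul1mx mulmx1 Px.
  rewrite mulmxDr mulmxA DP -[P *m _ *m _]mulmxA DD mulmx1 mulmxBr mulmx1 -scalemxAr.
  rewrite mulmxBr mulmx1 yE !mulmxBl mul1mx; move: (x *m P) => Q {e00 e01 e10 e11 Px xy DD DP yE}.
  by apply/matrixP => i j; rewrite !mxE; ring.
apply: (circuit_mul (d := 1) (d' := 1)); last exact: circuit_one_qubit.
by rewrite -[on_qubits _ _](controlled_set0 xpred0); apply: circuit_one_qubit; rewrite ?inE.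
Qed.

End Circuits.
End OneQubit.

(** The equations cos p cos q = u and sin p sin q = v say that cos(p+q) = u - v and cos(p-q) = u +
    v, both of which lie in [-1, 1]. *)
Lemma lcu_angles (R : realType) (u v : R) : `|u| + `|v| <= 1 ->
  exists x y x' y' : R, [/\ x ^+ 2 + y ^+ 2 = 1, x' ^+ 2 + y' ^+ 2 = 1,
    x * x' = u & - (y * y') = v].
Proof.
move=> uv; have [h1 h2] : -1 <= u + v <= 1 /\ -1 <= u - v <= 1.
  have := ler_norm u; have := ler_norm (- u); have := ler_norm v; have := ler_norm (- v).
  by rewrite !normrN; split; lra.
pose s := acos (u - v); pose d := acos (u + v).
have cs : cos s = u - v by rewrite acosK.
have cd : cos d = u + v by rewrite acosK.
pose p := (s + d) / 2; pose q := (s - d) / 2.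
have sE : s = p + q by rewrite /p /q; field.
have dE : d = p - q by rewrite /p /q; field.
rewrite sE cosD in cs; rewrite dE cosB in cd.
exists (cos p), (sin p), (cos q), (- sin q); split.
- by rewrite cos2Dsin2.
- by rewrite sqrrN cos2Dsin2.
- lra.
- lra.
Qed.

(** * Sums and products of block-encodings *)

Section AbstractBlocks.
Variables (C : numClosedFieldType) (m : nat).
Implicit Types (P Q X Y U V : 'M[C]_m).

Lemma adjmxM4 X Y U V : (X *m (Y *m U) *m V)^t* = V^t* *m (U^t* *m Y^t* ) *m X^t*.
Proof. by rewrite !adjmxM mulmxA. Qed.

(** Each factor commutes with the projector of the other, their ancillas being disjoint, so the
    compression of the product splits. *)
Lemma block_product P Q X Y LX LY :
  P *m Q = Q *m P -> P *m Y = Y *m P -> Q *m X = X *m Q -> Q *m LX = LX *m Q ->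
  P *m X *m P = P *m LX -> Q *m Y *m Q = Q *m LY ->
  P *m Q *m (X *m Y) *m (P *m Q) = P *m Q *m (LX *m LY).
Proof.
move=> PQ PY QX QLX XE YE; transitivity ((P *m X *m P) *m (Q *m Y *m Q)).
  rewrite !mulmxA -[P *m Q *m X]mulmxA QX !mulmxA.
  rewrite -[P *m X *m Q *m Y *m P]mulmxA -PY.
  by rewrite -[P *m X *m Q *m _]mulmxA [Q *m (P *m _)]mulmxA -PQ !mulmxA.
by rewrite XE YE !mulmxA -[P *m _ *m Q]mulmxA -QLX !mulmxA.
Qed.

Variable f : bool -> bool -> 'M[C]_m.
Hypothesis fM : forall i j k l, f i j *m f k l = if j == k then f i l else 0.
Local Notation rot x y := (x *: f false false - y^* *: f false true
  + y *: f true false + x^* *: f true true).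

Lemma lcu_compress x y x' y' U : (forall i j, U *m f i j = f i j *m U) ->
  f false false *m (rot x y *m (f true true *m U + f false false) *m rot x' y')
    *m f false false
  = f false false *m ((x * x') *: 1%:M - (y^* * y') *: U).
Proof.
move=> Uf; rewrite -!mulmxA.
have l2 : rot x' y' *m f false false = x' *: f false false + y' *: f true false.
  rewrite !(mulmxDl, mulNmx) -!scalemxAl !fM /=.
  by rewrite !scaler0 oppr0 !addr0.
have l1 : f false false *m rot x y = x *: f false false - y^* *: f false true.
  by rewrite !(mulmxDr, mulmxN) -!scalemxAr !fM /= !scaler0 !addr0.
have l3 : (f true true *m U + f false false) *m (x' *: f false false + y' *: f true false)
   = x' *: f false false + y' *: (f true false *m U).
  rewrite mulmxDl !mulmxDr -!scalemxAr -!mulmxA !Uf !mulmxA !fM /=.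
  by rewrite mul0mx !scaler0 add0r addr0 addrC.
rewrite l2 l3 mulmxA l1 !mulmxDl !mulmxDr !mulNmx -!scalemxAl -!scalemxAr !mulmxA !fM /=.
by rewrite mul0mx !scaler0 oppr0 addr0 add0r mulmx1 mulmxN -scalemxAr !scalerA.
Qed.

Lemma lcu_block_encoding P Q V U L u v :
  P = f false false *m Q -> Q *m Q = Q ->
  (forall i j, Q *m f i j = f i j *m Q) ->
  f false false *m V *m f false false = f false false *m (u *: 1%:M + v *: U) ->
  Q *m U *m Q = Q *m L -> P *m L = L *m P ->
  P *m V *m P = (u *: 1%:M + v *: L) *m P.
Proof.
move=> flag_projE QQ Qf fV QU PL.
have -> : P *m V *m P = Q *m (f false false *m V *m f false false) *m Q.
  by rewrite {1}flag_projE -Qf flag_projE !mulmxA.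
rewrite fV mulmxA Qf -!mulmxA mulmxDl mulmxDr -!scalemxAl -!scalemxAr mul1mx QQ.
rewrite [Q *m (U *m Q)]mulmxA QU mulmxDr -!scalemxAr mulmxA -flag_projE PL.
by rewrite mulmxDl -!scalemxAl mul1mx.
Qed.

Lemma comm_mul P Q (g : bool -> bool -> 'M[C]_m) :
  (forall i j, P *m g i j = g i j *m P) -> (forall i j, Q *m g i j = g i j *m Q) ->
  forall i j, P *m Q *m g i j = g i j *m (P *m Q).
Proof. by move=> hP hQ i j; rewrite -mulmxA hQ mulmxA hP mulmxA. Qed.

Lemma comm_controlled P U (g : bool -> bool -> 'M[C]_m) :
  (forall i j, P *m g i j = g i j *m P) -> (forall i j, U *m g i j = g i j *m U) ->
  forall i j, (P *m U + (1%:M - P)) *m g i j = g i j *m (P *m U + (1%:M - P)).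
Proof.
move=> hP hU i j; rewrite mulmxDl mulmxDr mulmxBl mulmxBr mul1mx mulmx1 hP.
by rewrite -mulmxA hU mulmxA hP mulmxA.
Qed.

(* The block-encoding V and its inverse U need no control: they cancel when the
   reflections are switched off. *)
Lemma controlled_walk r V U :
  (forall i j, r *m f i j = f i j *m r) -> (forall i j, V *m f i j = f i j *m V) ->
  (forall i j, U *m f i j = f i j *m U) -> U *m V = 1%:M ->
  f false false *m (r *m U *m r *m V) + f true true =
  (f false false *m r + f true true) *m U *m ((f false false *m r + f true true) *m V).
Proof.
move=> rf Vf Uf UV.
have X Y : (f false false *m r + f true true) *m Y = f false false *m (r *m Y) + f true true *m Y.
  by rewrite mulmxDl mulmxA.
rewrite -[RHS]mulmxA !X mulmxDr [U *m (f false false *m _)]mulmxA Uf.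
rewrite [U *m (f true true *m _)]mulmxA Uf -!mulmxA UV mulmx1.
rewrite !mulmxDr [r *m (f _ _ *m _)]mulmxA rf [r *m (f true true)]rf.
by rewrite !mulmxA !fM /= !mul0mx addr0 add0r.
Qed.

(** The identity for [Y] holds only on the image of [P]. [J] lies there and [X] commutes with [P],
    so X J still does. For this reason the final encoding of A^-1 has a register of its own,
    separate from the one inside the linear combination. *)
Lemma compress_product k P Q X Y LT LX (J : 'M[C]_(m, k)) :
  f false false *m J = J -> P *m J = J -> Q *m J = J ->
  J^t* *m f false false = J^t* -> J^t* *m Q = J^t* ->
  (forall i j, X *m f i j = f i j *m X) -> P *m X = X *m P ->
  f false false *m Y *m f false false *m P = f false false *m (LT *m P) ->
  Q *m X *m Q = Q *m LX -> Q *m LT = LT *m Q -> Q *m P = P *m Q ->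
  Q *m LX = LX *m Q -> P *m LX = LX *m P ->
  J^t* *m (Y *m X) *m J = J^t* *m (LT *m LX) *m J.
Proof.
move=> fJ PJ QJ Jf JQ Xf PX YE XE QT QP QX PLX.
have XJ : X *m J = f false false *m (P *m (X *m J)).
  by rewrite [P *m (X *m J)]mulmxA PX -mulmxA PJ mulmxA -Xf -mulmxA fJ.
have LTJ (w : 'M[C]_(m, k)) : J^t* *m (LT *m w) = J^t* *m (LT *m (Q *m w)).
  by rewrite -{1}JQ -mulmxA [Q *m (LT *m w)]mulmxA QT -mulmxA.
have QPXJ : Q *m (P *m (X *m J)) = LX *m J.
  rewrite mulmxA QP -mulmxA -{1}QJ [X *m (Q *m J)]mulmxA [Q *m (X *m Q *m J)]mulmxA.
  rewrite [Q *m (X *m Q)]mulmxA XE QX -[LX *m Q *m J]mulmxA QJ.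
  by rewrite mulmxA PLX -mulmxA PJ.
rewrite -!mulmxA {1}XJ -{1}Jf -!mulmxA.
rewrite (_ : f false false *m (Y *m (f false false *m (P *m (X *m J)))) =
   f false false *m (LT *m (P *m (X *m J)))); last first.
  by move: YE => /(congr1 (mulmx^~ (X *m J))); rewrite /= -!mulmxA.
by rewrite mulmxA Jf LTJ QPXJ.
Qed.

End AbstractBlocks.

Section OnQubitsAlgebra.
Variable R : realType.
Local Notation C := R[i].
Variables (N k : nat) (q : 'I_k -> 'I_N).
Hypothesis qi : injective q.

Lemma on_qubitsX (U : 'M[C]_(2 ^ k)) j : on_qubits q (U ^+ j) = on_qubits q U ^+ j.
Proof.
elim: j => [|j IH]; first by rewrite !expr0 on_qubits1.
by rewrite !exprS -IH; apply/esym/on_qubitsM.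
Qed.

Lemma on_qubits_sum (I : finType) (f : I -> 'M[C]_(2 ^ k)) :
  on_qubits q (\sum_i f i) = \sum_i on_qubits q (f i).
Proof.
elim/big_rec2 : _ => [|i x y _ <-]; first exact: on_qubits0.
exact: on_qubitsD.
Qed.

Lemma on_qubits_poly d (t : nat -> C) (X Y : 'M[C]_(2 ^ k)) :
  (\sum_(j < d.+1) t j *: (on_qubits q X *m on_qubits q Y) ^+ j) *m on_qubits q X =
  on_qubits q ((\sum_(j < d.+1) t j *: (X *m Y) ^+ j) *m X).
Proof.
rewrite on_qubitsM // -[RHS](on_qubitsM _ _ qi) on_qubits_sum; congr (_ *m _).
by apply: eq_bigr => j _; rewrite on_qubitsZ on_qubitsX.
Qed.

End OnQubitsAlgebra.

(** * Wiring of the registers and gate counts *)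

Section Registers.
Variable R : realType.
Local Notation C := R[i].
Variables (a n mA mB : nat) (UA : 'M[C]_(2 ^ (mA + n))) (UB : 'M[C]_(2 ^ (mB + n))).
Hypotheses (uA : UA \is unitarymx) (uB : UB \is unitarymx).
Variables (c l : 'I_a) (p1 p2 : 'I_mA -> 'I_a) (pB : 'I_mB -> 'I_a).
Hypotheses (cl : c != l) (p1i : injective p1) (p2i : injective p2) (pBi : injective pB).
Hypotheses (p1c : forall i, p1 i != c) (p2c : forall i, p2 i != c) (pBc : forall i, pB i != c).
Hypotheses (p1l : forall i, p1 i != l) (p2l : forall i, p2 i != l) (pBl : forall i, pB i != l).
Hypotheses (p12 : forall i j, p1 i != p2 j) (p1B : forall i j, p1 i != pB j).
Hypothesis (p2B : forall i j, p2 i != pB j).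

Local Notation N := (a + n)%N.
Local Notation circ := (@circuit_with R N _ _ UA UB).
Local Notation sys := (@rshift a n).
Local Notation encA := ((ket0_tens R mA n)^t* *m UA *m ket0_tens R mA n).
Local Notation encB := ((ket0_tens R mB n)^t* *m UB *m ket0_tens R mB n).
Local Notation ql := (lshift n l).
Local Notation qc := (lshift n c).
Local Notation f := (qunit R ql).
Local Notation e := (qunit R qc).
Local Notation oA1 := (on_qubits (anc_reg p1) UA).
Local Notation oA := (on_qubits (anc_reg p2) UA).
Local Notation oB := (on_qubits (anc_reg pB) UB).
Local Notation PA1 := (qproj R (anc_set n p1) xpred0).
Local Notation PA := (qproj R (anc_set n p2) xpred0).
Local Notation PB := (qproj R (anc_set n pB) xpred0).
Let S : {set 'I_N} := [set ql] :|: (anc_set n p2 :|: anc_set n pB).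
Local Notation P := (qproj R S xpred0).

Lemma anc_reg_neq m (p : 'I_m -> 'I_a) i j :
  (forall k, p k != i) -> anc_reg p j != lshift n i.
Proof.
move=> pi; rewrite /anc_reg; case: (fintype.split j) => k.
  by rewrite (inj_eq (@lshift_inj _ _)).
by rewrite eq_rlshift.
Qed.

Lemma anc_reg_notin m m' (p : 'I_m -> 'I_a) (p' : 'I_m' -> 'I_a) j :
  (forall i k, p i != p' k) -> anc_reg p j \notin anc_set n p'.
Proof.
move=> pp; apply/imsetP => [[k _]] /eqP.
by apply/negP/anc_reg_neq => i; exact: pp.
Qed.

Lemma lshift_notin m (p : 'I_m -> 'I_a) i :
  (forall k, p k != i) -> lshift n i \notin anc_set n p.
Proof.
move=> pi; apply/imsetP => [[k _]] /eqP.
by rewrite (inj_eq (@lshift_inj _ _)) eq_sym (negbTE (pi k)).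
Qed.

Lemma rshift_notin m (p : 'I_m -> 'I_a) (i : 'I_n) : rshift a i \notin anc_set n p.
Proof. by apply/imsetP => [[k _]] /eqP; rewrite eq_rlshift. Qed.

Lemma rshift_notin1 (i : 'I_n) (j : 'I_a) : rshift a i \notin [set lshift n j].
Proof. by rewrite inE eq_rlshift. Qed.

Lemma rshift_notinS i : sys i \notin S.
Proof. by rewrite !finset.in_setU !negb_or rshift_notin1 !rshift_notin. Qed.

Lemma control_notin_flags : qc \notin S.
Proof.
by rewrite !finset.in_setU !negb_or finset.in_set1 (inj_eq (@lshift_inj _ _)) cl !lshift_notin.
Qed.

Lemma flag_projE : P = f false false *m (PA *m PB).
Proof. by rewrite !qprojU (qunit_qproj R ql xpred0). Qed.

Let sysi : injective sys. Proof. exact: rshift_inj. Qed.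

Lemma lcu_block :
  PA *m PB *m (oA *m oB) *m (PA *m PB) = PA *m PB *m on_qubits sys (encA *m encB).
Proof.
have AB : PA *m PB = PB *m PA by rewrite -!qprojU finset.setUC.
have AoB : PA *m oB = oB *m PA.
  apply: qproj_comm_on_qubits => j; apply: anc_reg_notin => i k.
  by rewrite eq_sym.
have BoA : PB *m oA = oA *m PB.
  by apply: qproj_comm_on_qubits => j; apply: anc_reg_notin.
have LB : PB *m on_qubits sys encA = on_qubits sys encA *m PB.
  by apply: qproj_comm_on_qubits => j; apply: rshift_notin.
rewrite -(on_qubitsM _ _ sysi).
exact: block_product AB AoB BoA LB (anc_block p2 UA) (anc_block pB UB).
Qed.

Variables (u v : R).
Hypothesis uv : `|u| + `|v| <= 1.
Local Notation M := (u%:C *: 1%:M + v%:C *: (encA *m encB)).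

Lemma application_controlled m (p : 'I_m -> 'I_a) (U V : 'M[C]_(2 ^ (m + n))) :
  V = U \/ V = invmx U -> injective p -> (forall i, p i != l) ->
  application U (controlled [set ql] xpredT (on_qubits (anc_reg p) V)).
Proof.
move=> VU pi pl; apply: Application => //; first exact: anc_reg_inj.
  by rewrite cards1.
by move=> j; rewrite finset.in_set1 anc_reg_neq.
Qed.

Lemma rotation_gate s t : s ^+ 2 + t ^+ 2 = 1 -> exists X,
  [/\ circ 1 X, circ 1 (X^t* ), forall i j, X *m e i j = e i j *m X &
      X = s%:C *: f false false - Num.conj (t%:C : C) *: f false true
          + t%:C *: f true false + Num.conj (s%:C : C) *: f true true].
Proof.
have cr (w : R) : Num.conj (w%:C : C) = w%:C by rewrite conj_Creal // complex_real.
have nrm (w w' : R) : w ^+ 2 + w' ^+ 2 = 1 ->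
    w%:C * Num.conj (w%:C : C) + w'%:C * Num.conj (w'%:C : C) = 1.
  by move=> st; rewrite !cr -!rmorphM -rmorphD -!expr2 st.
have gate (w w' : R) : w ^+ 2 + w' ^+ 2 = 1 ->
    circ 1 (on_qubits (fun _ : 'I_1 => ql) (rotmx (w%:C : C) w'%:C)).
  by move=> st; rewrite rot_qunit; apply/circuit_rot/nrm.
move=> st; exists (on_qubits (fun _ : 'I_1 => ql) (rotmx (s%:C : C) t%:C)); split.
- exact: gate.
- rewrite on_qubits_adj rotmx_adj [X in rotmx X _]cr -rmorphN.
  by apply: gate; rewrite sqrrN.
- move=> i j; apply: qunit_comm; first exact: one_qubit_inj.
  by move=> _; rewrite (inj_eq (@lshift_inj _ _)) eq_sym.
- exact: rot_qunit.
Qed.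

Lemma controlled_gate m (p : 'I_m -> 'I_a) (U : 'M[C]_(2 ^ (m + n))) :
  U \is unitarymx -> injective p -> (forall i, p i != l) -> (forall i, p i != c) ->
  (forall G : 'M[C]_(2 ^ N), application U G -> circ 1 G) ->
  exists Y, [/\ circ 1 Y, circ 1 (Y^t* ), forall i j, Y *m e i j = e i j *m Y &
    Y = f true true *m on_qubits (anc_reg p) U + f false false].
Proof.
move=> uU pi pl pc hc.
exists (controlled [set ql] xpredT (on_qubits (anc_reg p) U)); split.
- by apply: hc; apply: application_controlled => //; left.
- rewrite controlled_adj ?on_qubits_adj; last first.
    by apply: qproj_comm_on_qubits => j; rewrite finset.in_set1 anc_reg_neq.
  by apply: hc; apply: application_controlled => //; right; rewrite invmx_unitary.
- rewrite controlledE; apply: comm_controlled => i j.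
    by apply: qproj_qunit_comm; rewrite finset.in_set1 (inj_eq (@lshift_inj _ _)).
  by apply: qunit_comm; [exact: anc_reg_inj | move=> j'; apply: anc_reg_neq].
- rewrite controlledE (qunit_qproj R ql xpredT).
  by congr (_ + _); rewrite -(qunit1 R ql) addrK.
Qed.

Lemma oracle_comm m (p : 'I_m -> 'I_a) (U : 'M[C]_(2 ^ (m + n))) (b : 'I_a) :
  injective p -> (forall i, p i != b) -> forall i j,
  on_qubits (anc_reg p) U *m qunit R (lshift n b) i j =
  qunit R (lshift n b) i j *m on_qubits (anc_reg p) U.
Proof.
move=> pi pb i j; apply: qunit_comm; first exact: anc_reg_inj.
by move=> j'; exact: anc_reg_neq.
Qed.

(** Two rotations of the flag enclose the two oracles, both controlled by the flag: flag 0
    contributes the identity with weight u, flag 1 the product with weight v. *)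
Lemma lcu_circuit : exists V, [/\ circ 4 V, circ 4 (V^t* ),
  (forall i j, V *m e i j = e i j *m V) & P *m V *m P = on_qubits sys M *m P].
Proof.
have [x [y [x' [y' [xy xy' xx yy]]]]] := lcu_angles uv.
have [X1 [cX1 cX1' eX1 X1E]] := rotation_gate xy.
have [X2 [cX2 cX2' eX2 X2E]] := rotation_gate xy'.
have [|Y1 [cY1 cY1' eY1 Y1E]] := controlled_gate uA p2i p2l p2c.
  by move=> G hG; apply/circuit_gate/Or31.
have [|Y2 [cY2 cY2' eY2 Y2E]] := controlled_gate uB pBi pBl pBc.
  by move=> G hG; apply/circuit_gate/Or32.
have fA := oracle_comm UA p2i p2l; have fB := oracle_comm UB pBi pBl.
have LB := lcu_block.
have Qf : forall i j, PA *m PB *m f i j = f i j *m (PA *m PB).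
  by apply: comm_mul => i j; apply: qproj_qunit_comm; apply: lshift_notin.
have QQ : PA *m PB *m (PA *m PB) = PA *m PB by rewrite -qprojU qproj_idem.
have PL : P *m on_qubits sys (encA *m encB) = on_qubits sys (encA *m encB) *m P.
  by apply: qproj_comm_on_qubits => j; apply: rshift_notinS.
exists (X1 *m (Y1 *m Y2) *m X2); split.
- apply: (circuit_mul (d := 3) (d' := 1)) => //.
  apply: (circuit_mul (d := 1) (d' := 2)) => //.
  exact: (circuit_mul (d := 1) (d' := 1)).
- rewrite adjmxM4.
  apply: (circuit_mul (d := 3) (d' := 1)) => //.
  apply: (circuit_mul (d := 1) (d' := 2)) => //.
  exact: (circuit_mul (d := 1) (d' := 1)).
- exact: comm_mul (comm_mul eX1 (comm_mul eY1 eY2)) eX2.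
rewrite on_qubitsD !on_qubitsZ on_qubits1 //.
move: flag_projE (@qunitM R N ql) => PE' fM.
move: (on_qubits (anc_reg p2) UA) (on_qubits (anc_reg pB) UB) (on_qubits sys _)
  (qproj R S xpred0) (PA *m PB) (qunit R ql) fM fA fB LB Qf QQ PL PE' X1E X2E Y1E Y2E.
move=> A' B' L' P' Q' f' fM fA fB LB Qf QQ PL PE' X1E X2E Y1E Y2E.
have G : Y1 *m Y2 = f' true true *m (A' *m B') + f' false false.
  rewrite Y1E Y2E mulmxDl !mulmxDr -[f' _ _ *m A' *m _]mulmxA [A' *m (_ *m B')]mulmxA fA.
  rewrite -!mulmxA [A' *m f' _ _]fA !mulmxA !fM /= !mul0mx.
  by rewrite addr0 add0r.
have cr (w : R) : Num.conj (w%:C : C) = w%:C by rewrite conj_Creal // complex_real.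
apply: (lcu_block_encoding PE' QQ Qf _ LB PL).
rewrite G X1E X2E (lcu_compress fM); last exact: comm_mul.
by rewrite cr -!rmorphM xx -scaleNr -rmorphN yy.
Qed.

Lemma sys_block0 (K : 'M[C]_(2 ^ n)) :
  (ket0_tens R a n)^t* *m on_qubits sys K *m ket0_tens R a n = K.
Proof.
have h0 i : sys i \notin (finset.set0 : {set 'I_N}) by rewrite finset.in_set0.
by have := sys_block K h0; rewrite qproj_set0 mul1mx.
Qed.

Lemma inversion_block d (t : {poly C}) :
  (forall z, `|z| = 1 -> `|(circle_lift d t).[z]| < 1) ->
  exists W, circ ((2 * d).+1 * 13 + 1 + d * 12 + 6 + 1) W /\
    (ket0_tens R a n)^t* *m W *m ket0_tens R a n =
    (\sum_(k < d.+1) t`_k *: (M^t* *m M) ^+ k) *m M^t* *m encA.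
Proof.
move=> t1; have [V [cV cVi Ve PVP]] := lcu_circuit.
have uV := circuit_unitary uA uB cV.
have VVi := unitarymxP uV.
have ViV : V^t* *m V = 1%:M.
  have /unitarymxP : V^t* \is unitarymx by rewrite trmxC_unitary.
  by rewrite trmxCK.
have Pe i j : P *m e i j = e i j *m P by apply: qproj_qunit_comm; exact: control_notin_flags.
have e_adj i j : (e i j)^t* = e j i by rewrite /qunit on_qubits_adj munit_adj.
have Vie i j : V^t* *m e i j = e i j *m V^t*.
  have := Ve j i; move/(congr1 (fun X : 'M[C]_(2 ^ N) => X^t* )).
  by rewrite !adjmxM e_adj => <-.
have Psys K : P *m on_qubits sys K = on_qubits sys K *m P.
  by apply: qproj_comm_on_qubits => j; apply: rshift_notinS.
have PViP : P *m V^t* *m P = on_qubits sys (M^t* ) *m P.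
  rewrite -Psys -on_qubits_adj -{1 2 3}(qproj_adj R S xpred0).
  have := congr1 (fun X : 'M[C]_(2 ^ N) => X^t* ) PVP.
  by rewrite /= !adjmxM mulmxA.
have cr := circuit_reflection UA UB control_notin_flags.
have ccr := circuit_controlled_reflection UA UB control_notin_flags.
have rE : 2 *: P - 1%:M = 2 *: P - 1%:M by [].
have PP := qproj_idem R S xpred0.
have fM := @qunitM R N qc.
have re i j : (2 *: P - 1%:M) *m e i j = e i j *m (2 *: P - 1%:M).
  by rewrite mulmxBl mulmxBr mul1mx mulmx1 -scalemxAl -scalemxAr Pe.
have N0 : (0 < 2 ^ N)%N by rewrite expn_gt0.
have cmul := @circuit_mul R N _ _ UA UB.
(* A reflection costs 2 gates, controlled or not, and [V] or its adjoint costs 4. This makes 12 for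
   the controlled walk, 12 for the inverse walk and 6 for the half step. *)
have [|||W [cW WE]] := inversion_circuit_mx (circ := circ) N0 cmul fM
   (@circuit_rot R N _ _ UA UB qc) VVi ViV PP rE PVP PViP (Psys _) (Psys _) Ve Vie Pe
   (g := 12) (gi := 12) (gv := 6) _ _ _ t1.
- rewrite (controlled_walk fM re Ve Vie ViV).
  apply: (cmul 6 6); first exact: (cmul 2 4).
  exact: (cmul 2 4).
- apply: (cmul 10 2) => //; apply: (cmul 6 4) => //; exact: (cmul 4 2).
- exact: (cmul 4 2).
exists (W *m oA1); split.
  apply: cmul => //; rewrite -[oA1](controlled_set0 xpredT).
  apply/circuit_gate/Or31; apply: Application => //; first by left.
  - exact: anc_reg_inj.
  - by rewrite cards0.
  - by move=> j; rewrite finset.in_set0.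
rewrite (on_qubits_poly sysi) in WE.
have ketP (T : {set 'I_N}) : (forall i, sys i \notin T) ->
    (ket0_tens R a n)^t* *m qproj R T xpred0 = (ket0_tens R a n)^t*.
  by move=> hT; rewrite -{1}(qproj_adj R T) -adjmxM qproj_ket0.
have eE : e false false = qproj R [set qc] xpred0 by rewrite qunit_qproj.
have -> : (ket0_tens R a n)^t* *m (W *m oA1) *m ket0_tens R a n =
   (ket0_tens R a n)^t* *m (on_qubits sys ((\sum_(k < d.+1) t`_k *: (M^t* *m M) ^+ k) *m M^t* )
      *m on_qubits sys encA) *m ket0_tens R a n.
  apply: (compress_product (f := e) (P := P) (Q := PA1)) WE _ _ _ _ _.
  - by rewrite eE qproj_ket0 // => i; exact: rshift_notin1.
  - by rewrite qproj_ket0 // => i; exact: rshift_notinS.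
  - by rewrite qproj_ket0 // => i; exact: rshift_notin.
  - by rewrite eE ketP // => i; exact: rshift_notin1.
  - by rewrite ketP // => i; exact: rshift_notin.
  - exact: oracle_comm.
  - apply: qproj_comm_on_qubits => j; rewrite !finset.in_setU !negb_or finset.in_set1.
    by rewrite anc_reg_neq // !anc_reg_notin.
  - exact: anc_block.
  - by apply: qproj_comm_on_qubits => j; exact: rshift_notin.
  - by rewrite -!qprojU finset.setUC.
  - by apply: qproj_comm_on_qubits => j; exact: rshift_notin.
  - exact: Psys.
by rewrite on_qubitsM // sys_block0.
Qed.

End Registers.

(** * Assembly of the circuit and its error *)

Section Main.
Variable R : realType.
Local Notation C := R[i].

Lemma sigma_min_lower m (X : 'M[C]_m) v : (0 < m)%N -> 0 <= sigma_min X ->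
  sigma_min X * l2norm v <= l2norm (X *m v).
Proof.
move=> m0 sm0; have [P [s [uP sX XX]]] := gram_spectral X.
pose D : 'M[C]_m := diag_mx (\row_i (s i)%:C).
have -> : l2norm (X *m v) = l2norm (D *m (P *m v)).
  have DD : D^t* *m D = diag_mx (\row_i (s i ^+ 2)%:C).
    rewrite tr_diag_mx map_diag_mx mulmx_diag; congr diag_mx.
    apply/rowP => i; rewrite !mxE [X in X * _](_ : _ = (s i)%:C) -?rmorphM ?expr2 //.
    by apply: (conj_Creal (C := C)); rewrite complex_real.
  apply: l2norm_eq; rewrite (adjmxM X v) (adjmxM D) (adjmxM P v).
  transitivity ((v^t* *m (X^t* *m X) *m v) 0 0); first by rewrite !mulmxA.
  by rewrite XX -DD !mulmxA.
rewrite -(l2norm_unitary v uP); move: (P *m v) => w.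
have -> : sigma_min X = Num.sqrt (sigma_min X ^+ 2) by rewrite sqrtr_sqr ger0_norm.
rewrite /l2norm -sqrtrM ?sqr_ge0 // ler_wsqrtr // mulr_sumr; apply: ler_sum => i _.
rewrite mul_diag_mx !mxE ComplexField.Normc.normcM exprMn normc_real.
rewrite ler_wpM2r ?sqr_ge0 // real_normK ?num_real //.
by rewrite lerXn2r ?nnegrE // ?sigma_min_le //; case: (sX i).
Qed.

Lemma inversion_encoding n mA mB (UA : 'M[C]_(2 ^ (mA + n))) (UB : 'M[C]_(2 ^ (mB + n)))
    (u v : R) d (t : {poly C}) :
  UA \is unitarymx -> UB \is unitarymx -> `|u| + `|v| <= 1 ->
  (forall z, `|z| = 1 -> `|(circle_lift d t).[z]| < 1) ->
  let encA := (ket0_tens R mA n)^t* *m UA *m ket0_tens R mA n in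
  let encB := (ket0_tens R mB n)^t* *m UB *m ket0_tens R mB n in
  let M := u%:C *: 1%:M + v%:C *: (encA *m encB) in
  let J := ket0_tens R (2 * mA + mB + 3) n in
  exists W, [/\ W \is unitarymx, circuit_with UA UB (38 * d + 21) W &
    J^t* *m W *m J = (\sum_(k < d.+1) t`_k *: (M^t* *m M) ^+ k) *m M^t* *m encA].
Proof.
move=> uA uB uv t1 encA encB M J; set a := (2 * mA + mB + 3)%N.
have h0 : (0 < a)%N by rewrite /a; lia.
have h1 : (1 < a)%N by rewrite /a; lia.
have hp1 (i : 'I_mA) : (3 + i < a)%N by rewrite /a; have := ltn_ord i; lia.
have hp2 (i : 'I_mA) : (3 + mA + i < a)%N by rewrite /a; have := ltn_ord i; lia.
have hpB (i : 'I_mB) : (3 + 2 * mA + i < a)%N by rewrite /a; have := ltn_ord i; lia.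
(* Qubit 0 is the control of the signal processing and qubit 1 the flag of the linear combination;
   qubit 2 stays idle. The register for the final A^-1 comes next, then the two registers inside the
   linear combination. *)
pose q0 : 'I_a := Ordinal h0; pose q1 : 'I_a := Ordinal h1.
pose r1 (i : 'I_mA) : 'I_a := Ordinal (hp1 i).
pose r2 (i : 'I_mA) : 'I_a := Ordinal (hp2 i).
pose rB (i : 'I_mB) : 'I_a := Ordinal (hpB i).
have neq (x y : 'I_a) : (x : nat) <> y -> x != y.
  by move=> xy; apply/eqP => /(congr1 (@nat_of_ord a)).
have inj m (r : 'I_m -> 'I_a) k : (forall i, r i = (k + i)%N :> nat) -> injective r.
  by move=> rk i j /(congr1 (@nat_of_ord a)); rewrite !rk => /addnI/val_inj.
have [W [cW WE]] : exists W, circuit_with UA UB ((2 * d).+1 * 13 + 1 + d * 12 + 6 + 1) W /\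
   J^t* *m W *m J = (\sum_(k < d.+1) t`_k *: (M^t* *m M) ^+ k) *m M^t* *m encA.
  {
  apply: (@inversion_block R a n mA mB UA UB uA uB q0 q1 r1 r2 rB) => //.
  - exact: (inj _ _ 3).
  - exact: (inj _ _ (3 + mA)%N).
  - exact: (inj _ _ (3 + 2 * mA)%N).
  all: try by move=> i; apply: neq => /=; lia.
  all: move=> i j; apply: neq => /=; have := ltn_ord i; have := ltn_ord j; lia.
  }
exists W; split => //; first exact: (circuit_unitary uA uB cW).
by move: cW; congr (circuit_with _ _ _ _); lia.
Qed.

(** With w = (A + B)^-1 v one has M w = A^-1 v / alpha, and the scale factors 4 alphaA / (3 sigma)
    and 3 beta / 4 multiply to alphaA / alpha. The error on v is therefore the filter residual on w,
    and sigma |w| <= |X w| = |A^-1 v| bounds |w|. *)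
Lemma inversion_error n (A B : 'M[C]_(2 ^ n)) (encA M : 'M[C]_(2 ^ n)) d (t : {poly R})
    (alphaA sigma beta alpha eps : R) :
  A + B \in unitmx -> A \in unitmx ->
  (size t <= d.+1)%N -> 0 < beta -> 0 < alpha -> 0 < sigma -> beta = sigma / alpha ->
  invmx A = alphaA%:C *: encA ->
  (forall v, l2norm (encA *m v) <= l2norm v) ->
  alpha%:C *: M = 1%:M + invmx A *m B ->
  sigma <= sigma_min (1%:M + invmx A *m B) ->
  (forall v, l2norm (M *m v) <= l2norm v) ->
  (forall y, y <= 1 -> beta ^+ 2 <= y -> `|1 - y * t.[y]| <= eps) -> 0 <= eps ->
  opnorm (invmx (A + B) - (4 * alphaA / (3 * sigma))%:C *:
    ((\sum_(k < d.+1) (map_poly (real_complex R) ((3 / 4 * beta) *: t))`_k *: (M^t* *m M) ^+ k)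
       *m M^t* *m encA))
    <= eps * (`|alphaA| / sigma).
Proof.
move=> uAB uA st b0 a0 s0 bE AE cA ME sX cM ht e0.
set X := 1%:M + _ in ME sX.
have m0 : (0 < 2 ^ n)%N by rewrite expn_gt0.
apply: opnorm_le => // v.
pose T := \sum_(k < d.+1) (t`_k)%:C *: (M^t* *m M) ^+ k.
have -> : \sum_(k < d.+1) (map_poly (real_complex R) ((3 / 4 * beta) *: t))`_k *: (M^t* *m M) ^+ k
    = (3 / 4 * beta)%:C *: T.
  rewrite scaler_sumr; apply: eq_bigr => k _; rewrite coef_map coefZ scalerA.
  by rewrite [in RHS]mulrC -rmorphM mulrC.
pose w := invmx (A + B) *m v.
have AX : A *m X = A + B by rewrite mulmxDr mulmx1 mulKVmx.
have Xw : X *m w = invmx A *m v.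
  by rewrite /w mulmxA -[X](mulKmx uA) AX -!mulmxA mulKVmx.
have Mw : M *m w = (alpha^-1)%:C *: (invmx A *m v).
  rewrite -Xw -ME -scalemxAl scalerA -rmorphM mulVf ?gt_eqF // rmorph1.
  by rewrite scale1r.
have vE : (invmx (A + B) - (4 * alphaA / (3 * sigma))%:C *: ((3 / 4 * beta)%:C *: T *m M^t* *m encA)) *m v
    = (1%:M - T *m (M^t* *m M)) *m w.
  rewrite [RHS]mulmxBl mul1mx -!mulmxA Mw AE mulmxBl; congr (_ - _).
  rewrite -!scalemxAl -!scalemxAr !scalerA -!rmorphM -!mulmxA; congr (_ *: _).
  congr (_%:C); rewrite bE; field; rewrite ?gt_eqF //.
rewrite vE (le_trans (inversion_residual st b0 cM _ ht w)) //.
  move=> z; have := sigma_min_lower z m0 (le_trans (ltW s0) sX).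
  rewrite -ME -scalemxAl l2normZ normc_real gtr0_norm // => h.
  rewrite bE mulrAC ler_pdivrMr // [leRHS]mulrC; apply: le_trans h.
  by rewrite ME ler_wpM2r ?l2norm_ge0.
rewrite -mulrA ler_wpM2l // mulrAC ler_pdivlMr // mulrC.
have := sigma_min_lower w m0 (le_trans (ltW s0) sX); rewrite Xw.
rewrite AE -scalemxAl l2normZ normc_real => h.
apply: (@le_trans _ _ (sigma_min X * l2norm w)); first by rewrite ler_wpM2r ?l2norm_ge0.
by rewrite (le_trans h) // ler_wpM2l // normr_ge0.
Qed.

End Main.

(** * Choice of the parameters and the final count *)

Section Bounds.
Variable R : realType.

(** 975/1024 = 1 - 49/1024 is at most exp(-49/1024), and 21 exceeds 1024/49. *)
Lemma filter_order (x : R) (l : nat) : 0 < x -> 21 * ln x <= l%:R ->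
  (975 / 1024) ^+ l * x <= 1.
Proof.
move=> x0 hl; rewrite -[X in _ * X]lnK ?posrE //.
have e1 : 975 / 1024 <= expR (- (49 / 1024)) :> R.
  by rewrite (le_trans _ (expR_ge1Dx _)) //; lra.
apply: (@le_trans _ _ (expR (- (49 / 1024)) ^+ l * expR (ln x))).
  by rewrite ler_wpM2r ?expR_ge0 // lerXn2r ?nnegrE ?expR_ge0 //; lra.
rewrite -expRM_natl -expRD -[leRHS]expR0 ler_expR; have := ler0n R l; move: hl; lra.
Qed.

(** The thresholds absorb the additive terms: 1 + p <= (1 + 1/c0) p and 1 <= L / ln c1. With z = n0
    + 1 and y = l + 1, both at least 1, the count is 152 z y + 76 z + 21 <= 300 z y; rounding in z
    costs a further factor 3. *)
Lemma gate_count (c0 c1 p L sigma : R) n0 l :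
  0 < c0 -> 1 < c1 -> c0 <= p -> 0 < sigma -> sigma <= 1 + p -> ln c1 <= L ->
  n0.+1%:R <= (1 + p) / sigma + 2 -> l.+1%:R <= 21 * L + 1 ->
  (38 * (2 * n0.+1 * (2 * l.+1).+1) + 21)%N%:R
    <= 900 * (1 + c0^-1) * (21 + (ln c1)^-1) * (p / sigma * L).
Proof.
move=> c00 c11 c0p s0 sp lnL zq yL.
have lnc1 : 0 < ln c1 by rewrite ln_gt0.
have L0 : 0 < L by rewrite (lt_le_trans lnc1).
have p0 : 0 < p by rewrite (lt_le_trans c00).
have q1 : 1 <= (1 + p) / sigma by rewrite ler_pdivlMr // mul1r.
have z1 : 1 <= n0.+1%:R :> R by rewrite ler1n.
have y1 : 1 <= l.+1%:R :> R by rewrite ler1n.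
have zE : n0.+1%:R <= 3 * ((1 + c0^-1) * (p / sigma)).
  have : (1 + p) / sigma <= (1 + c0^-1) * (p / sigma).
    rewrite mulrA ler_pM2r ?invr_gt0 // mulrDl mul1r [leRHS]addrC lerD2r.
    by rewrite mulrC ler_pdivlMr // mul1r.
  lra.
have yE : l.+1%:R <= (21 + (ln c1)^-1) * L.
  have : 1 <= (ln c1)^-1 * L by rewrite mulrC ler_pdivlMr // mul1r.
  rewrite mulrDl; lra.
have -> : 900 * (1 + c0^-1) * (21 + (ln c1)^-1) * (p / sigma * L) =
   300 * ((3 * ((1 + c0^-1) * (p / sigma))) * ((21 + (ln c1)^-1) * L)).
  move: (c0^-1) ((ln c1)^-1) (p / sigma) => a b e; ring.
apply: (@le_trans _ _ (300 * (n0.+1%:R * l.+1%:R))); last first.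
  rewrite ler_pM2l ?ltr0n //; apply: ler_pM => //; exact: ler0n.
rewrite natrD !natrM -[(2 * l.+1).+1%:R]natr1 natrM.
move: z1 y1; set z := n0.+1%:R; set y := l.+1%:R => z1 y1.
have : 0 <= (z - 1) * (y - 1) by rewrite mulr_ge0 // subr_ge0.
have : 0 <= (z - 1) * y by rewrite mulr_ge0 ?subr_ge0 // (le_trans ler01).
have : 0 <= z * (y - 1) by rewrite mulr_ge0 ?subr_ge0 // (le_trans ler01).
lra.
Qed.

Lemma lcu_rescale m (alpha q : R) (E : 'M[R[i]]_m) : alpha != 0 ->
  alpha%:C *: ((alpha^-1)%:C *: 1%:M + (q / alpha)%:C *: E) = 1%:M + q%:C *: E.
Proof.
move=> a0; have h1 : alpha * alpha^-1 = 1 by rewrite mulfV.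
have h2 : alpha * (q / alpha) = q by rewrite mulrCA h1 mulr1.
by rewrite scalerDr !scalerA -!rmorphM h1 h2 rmorph1 scale1r.
Qed.

End Bounds.

Unset Implicit Arguments.

Theorem theorem13 (R : realType) :
  (forall (n : nat) (A B : 'M[R[i]]_(2 ^ n)),
     A \in unitmx -> A + B \in unitmx ->
     0 < 1 / (1 + opnorm (invmx (A + B)) * opnorm B)
       <= sigma_min (1%:M + invmx A *m B)) /\
  (forall c0 c1 : R, 0 < c0 -> 1 < c1 ->
   exists2 K : R, 0 < K &
   forall (n mA mB : nat) (A B : 'M[R[i]]_(2 ^ n))
     (alphaA alphaB : R)
     (UA : 'M[R[i]]_(2 ^ (mA + n))) (UB : 'M[R[i]]_(2 ^ (mB + n)))
     (sigma : R),
   A \in unitmx -> A + B \in unitmx ->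
   block_encoding alphaA 0 UA (invmx A) ->
   block_encoding alphaB 0 UB B ->
   0 < sigma -> sigma <= sigma_min (1%:M + invmx A *m B) ->
   forall delta : R, 0 < delta ->
   exists (d : nat) (W : 'M[R[i]]_(2 ^ (2 * mA + mB + 3 + n))),
     [/\ block_encoding (4 * alphaA / (3 * sigma)) delta W (invmx (A + B)),
         circuit_with UA UB d W
       & c0 <= alphaA * alphaB -> c1 <= alphaA / (delta * sigma) ->
         d%:R <= K * (alphaA * alphaB / sigma * ln (alphaA / (delta * sigma)))]).
Proof.
split=> [n A B uA uAB|c0 c1 c0gt0 c1gt1]; first by apply: sigma_min_bound; rewrite ?expn_gt0.
have lnc1 : 0 < ln c1 by rewrite ln_gt0.
exists (900 * (1 + c0^-1) * (21 + (ln c1)^-1)).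
  by rewrite !mulr_gt0 // addr_gt0 // invr_gt0.
move=> n mA mB A B alphaA alphaB UA UB sigma uA uAB encA encB s0 sX delta d0.
have m0 : (0 < 2 ^ n)%N by rewrite expn_gt0.
have [unA _] := encA; have [unB _] := encB.
have AE := exact_encoding encA; have BE := exact_encoding encB.
set eA := _ *m UA *m _ in AE; set eB := _ *m UB *m _ in BE.
have cA v : l2norm (eA *m v) <= l2norm v by exact: block_contraction.
have cB v : l2norm (eB *m v) <= l2norm v by exact: block_contraction.
set X := 1%:M + _ in sX.
(* The signs of [alphaA] and [alphaB] are left open here; in the gate count the threshold [c0] makes
   their product positive. *)
pose p := `|alphaA * alphaB|.
have XE : X = 1%:M + (alphaA * alphaB)%:C *: (eA *m eB).
  by rewrite /X AE BE -scalemxAl -scalemxAr scalerA -rmorphM.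
have s_le : sigma <= 1 + p.
  apply: (le_trans sX); apply: sigma_min_upper => // v.
  rewrite XE mulmxDl mul1mx (le_trans (l2normD _ _)) // mulrDl mul1r lerD2l.
  rewrite -scalemxAl l2normZ normc_real ler_wpM2l ?normr_ge0 //.
  by rewrite -mulmxA (le_trans (cA _)).
(* Here N > 2 (1 + p) / sigma, so alpha = 5 N sigma / 8 is at least 1 + p, as the linear combination
   requires. *)
pose n0 := Num.truncn ((1 + p) / sigma); pose N : R := (2 * n0.+1).+1%:R.
(* The constant 21 is that of [filter_order]. The absolute value covers large [delta], for which the
   logarithm is negative. *)
pose l := Num.truncn (21 * `|ln (`|alphaA| / (delta * sigma))|).
pose beta : R := 8 / (5 * N); pose alpha := sigma / beta.
have p0 : 0 <= p by exact: normr_ge0.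
have r0 : 0 <= (1 + p) / sigma by rewrite divr_ge0 ?ltW // ltr_pwDl.
have /andP[n0le n0gt] := truncn_itv r0; rewrite -/n0 in n0le n0gt.
have N0 : 0 < N by rewrite ltr0Sn.
have b0 : 0 < beta by rewrite divr_gt0 // mulr_gt0.
have a0 : 0 < alpha by rewrite divr_gt0.
have bE : beta = sigma / alpha by rewrite /alpha invf_div mulrCA divff ?mulr1 // gt_eqF.
have p_le : 1 + p <= alpha.
  rewrite /alpha ler_pdivlMr // /beta mulrA ler_pdivrMr ?mulr_gt0 //.
  move: n0gt; rewrite ltr_pdivrMr // => h.
  have NE : N = 2 * n0.+1%:R + 1 by rewrite /N -natr1 natrM.
  have : 0 < sigma * N by rewrite mulr_gt0.
  rewrite NE in N0 *; move: h; set z := n0.+1%:R; nra.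
pose u := alpha^-1; pose v := alphaA * alphaB / alpha.
have uv : `|u| + `|v| <= 1.
  have -> : `|u| = 1 / alpha by rewrite div1r gtr0_norm ?invr_gt0.
  have -> : `|v| = p / alpha by rewrite normrM normfV (gtr0_norm a0).
  by rewrite -mulrDl ler_pdivrMr // mul1r.
have [t [st ht ht1]] := inverse_filter R n0.+1 l.+1.
rewrite -/N -/beta in ht ht1.
pose d := (2 * n0.+1 * (2 * l.+1).+1)%N.
have st' : (size t <= d.+1)%N := leqW st.
have c_gt0 : 0 < 3 / 4 * beta by apply: mulr_gt0 => //; lra.
have t1 := circle_lift_lt1 st' c_gt0 ht1.
have [W [uW cW WE]] := inversion_encoding unA unB uv t1.
exists (38 * d + 21)%N, W; split=> //.
- split=> //; rewrite WE -/eA -/eB; pose M := u%:C *: 1%:M + v%:C *: (eA *m eB); rewrite -/M.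
  have ME : alpha%:C *: M = X.
    by rewrite XE /M /u /v lcu_rescale ?gt_eqF.
  have cM w : l2norm (M *m w) <= l2norm w.
    rewrite mulmxDl (le_trans (l2normD _ _)) // -!scalemxAl mul1mx !l2normZ !normc_real.
    rewrite -[leRHS]mul1r (le_trans _ (ler_wpM2r (l2norm_ge0 _) uv)) //.
    by rewrite mulrDl lerD2l ler_wpM2l // -mulmxA (le_trans (cA _)).
  apply: (le_trans (inversion_error uAB uA st' b0 a0 s0 bE AE cA ME sX cM ht _)).
    by apply: exprn_ge0; lra.
  (* The error bound carries the factor |alphaA|; at [alphaA = 0] it is zero, and the logarithm is
     avoided. *)
  have [->|aA0] := eqVneq alphaA 0; first by rewrite normr0 mul0r mulr0 ltW.
  have x0 : 0 < `|alphaA| / (delta * sigma) by rewrite divr_gt0 ?mulr_gt0 ?normr_gt0.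
  have : 21 * ln (`|alphaA| / (delta * sigma)) <= l.+1%:R.
    rewrite (@le_trans _ _ (21 * `|ln (`|alphaA| / (delta * sigma))|)) //.
      by rewrite ler_wpM2l // ler_norm.
    by have /andP[_ /ltW] := truncn_itv (mulr_ge0 (ler0n R 21) (normr_ge0 (ln (`|alphaA| / (delta * sigma))))).
  move=> /(filter_order x0) h.
  have -> : `|alphaA| / sigma = `|alphaA| / (delta * sigma) * delta.
    by field; rewrite !gt_eqF.
  by rewrite mulrA ler_piMl // ltW.
- move=> hc0 hc1.
  have pE : p = alphaA * alphaB by rewrite /p ger0_norm // (le_trans (ltW c0gt0)).
  have x0 : 0 < alphaA / (delta * sigma) by rewrite (lt_le_trans _ hc1) // (lt_trans ltr01).
  have aA0 : 0 < alphaA by move: x0; rewrite pmulr_lgt0 ?invr_gt0 ?mulr_gt0.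
  have lnc : ln c1 <= ln (alphaA / (delta * sigma)).
    by rewrite ler_ln ?posrE // (lt_trans ltr01).
  rewrite -pE; apply: gate_count => //.
  + by rewrite pE.
  + by rewrite -natr1; lra.
  have L0 : 0 <= ln (alphaA / (delta * sigma)) by rewrite (le_trans (ltW lnc1)).
  rewrite -natr1 lerD2r /l (gtr0_norm aA0) (ger0_norm L0).
  by rewrite truncn_le mulr_ge0.
Qed.
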